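(* Let $\phi_{(1)},\dots,\phi_{(p)}\in W(S^n)$, and let $\Theta\subset\mathbb{R}^p$ be a convex set such that $\phi_\theta:=\sum_{i=1}^p\theta_i\phi_{(i)}\in W(S^n)$ for every $\theta=(\theta_i)_{i=1}^p\in\Theta$. Define $p(x|\theta)=\mathrm{Jac}(G_{\phi_\theta}(x))$. Then, for any data points $x(1),\dots,x(N)\in S^n$ at each of which all of $\phi_{(1)},\dots,\phi_{(p)}$ have their Hessians defined, the likelihood function $\theta\mapsto\prod_{k=1}^N p(x(k)|\theta)$ is log-concave with respect to $\theta\in\Theta$.
   Context: $S^n\subset\mathbb{R}^{n+1}$ is the $n$-dimensional unit sphere with its standard Riemannian metric, $d(x,y)=\cos^{-1}(x^{\top}y)\in[0,\pi]$ is the geodesic distance, and the cost function is $c(x,y)=\frac12 d(x,y)^2$. The $c$-transform of $\phi:S^n\to\mathbb{R}$ is $\phi^c(y)=\sup_{x\in S^n}\{-c(x,y)-\phi(x)\}$, and $\phi$ is $c$-convex if $(\phi^c)^c=\phi$. The exponential map is $\exp_x(v)=(\cos|v|)x+(\sin|v|)v/|v|$ for $v\in T_xS^n$ (with $\exp_x(0)=x$). For $\phi$ differentiable at $x$, the gradient map is $G_\phi(x)=\exp_x(\nabla\phi(x))$. ''$\phi$ has its Hessian defined at $x$'' means that $\phi$ is twice differentiable at $x$ (differentiable near $x$, with gradient differentiable at $x$). $W(S^n)$ denotes the set of wrapping potential functions: $\phi\in W(S^n)$ if $\phi$ is $c$-convex, $\phi$ has its Hessian defined everywhere except at a finite set of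 points, and $G_\phi$ is (everywhere defined and) an isomorphism on $S^n$, i.e. a homeomorphism of $S^n$ onto itself. $\mathrm{Jac}(G_\phi(x))$ is the determinant of the differential of $G_\phi$ at $x$, computed in orthonormal bases of $T_xS^n$ and $T_{G_\phi(x)}S^n$ positively oriented with respect to a fixed orientation of $S^n$. A non-negative function $L$ on $\Theta$ is log-concave if $L((1-t)\theta+t\theta')\ge L(\theta)^{1-t}L(\theta')^{t}$ for all $\theta,\theta'\in\Theta$, $t\in(0,1)$. *)

(* Defs.v *)
(* Points of R^(n+1) are row vectors.  A function on S^n is represented by a
   total function on 'rV[R]_n.+1, of which only the values on [usphere] are
   ever used.  Pitfall: the library norm `|v| on 'rV[R]_n.+1 is the sup norm;
   the Euclidean norm is [enorm]. *)
From mathcomp Require Import all_boot all_order all_algebra.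
From mathcomp Require Import all_classical all_reals all_analysis.
Import Order.TTheory GRing.Theory Num.Theory.
Import numFieldNormedType.Exports.

Set Implicit Arguments.
Unset Strict Implicit.
Unset Printing Implicit Defensive.

Local Open Scope classical_set_scope.
Local Open Scope ring_scope.

Definition dotp (R : realType) (m : nat) (u v : 'rV[R]_m) : R :=
  (u *m v^T) 0 0.

Definition enorm (R : realType) (m : nat) (v : 'rV[R]_m) : R :=
  Num.sqrt (dotp v v).

Definition usphere (R : realType) (n : nat) : set 'rV[R]_n.+1 :=
  [set x | enorm x = 1].

Definition geodist (R : realType) (n : nat) (x y : 'rV[R]_n.+1) : R :=
  acos (dotp x y).

Definition cost (R : realType) (n : nat) (x y : 'rV[R]_n.+1) : R :=
  2^-1 * geodist x y ^+ 2.

(* The supremum is taken in the extended reals, so that it is +oo, and not a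
   default value, when the set is unbounded. *)
Definition ctransform (R : realType) (n : nat) (phi : 'rV[R]_n.+1 -> \bar R)
    (y : 'rV[R]_n.+1) : \bar R :=
  ereal_sup [set ((- cost x y)%:E - phi x)%E | x in @usphere R n].

Definition c_convex (R : realType) (n : nat) (phi : 'rV[R]_n.+1 -> R) : Prop :=
  forall x, usphere x -> ctransform (ctransform (EFin \o phi)) x = (phi x)%:E.

(* For v = 0 the second summand vanishes, so exps x 0 = x. *)
Definition exps (R : realType) (n : nat) (x v : 'rV[R]_n.+1) : 'rV[R]_n.+1 :=
  cos (enorm v) *: x + (sin (enorm v) / enorm v) *: v.

(* A map f on S^n is differentiable at x in S^n when its extension
   f \o retr to R^(n+1) \ {0}, constant along rays, is so at x; the
   differential of f at x is the restriction of 'd (f \o retr) x to the tangent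
   space T_x = {v | <x, v> = 0}, on which the differential of retr at x is the
   identity. *)
Definition retr (R : realType) (n : nat) (z : 'rV[R]_n.+1) : 'rV[R]_n.+1 :=
  (enorm z)^-1 *: z.

Definition sdifferentiable (R : realType) (n : nat) (V : normedModType R)
    (f : 'rV[R]_n.+1 -> V) (x : 'rV[R]_n.+1) : Prop :=
  differentiable (f \o @retr R n) x.

(* As phi \o retr is constant along rays, its Euclidean gradient at x is
   tangent to S^n at x, hence is the Riemannian gradient of phi. *)
Definition sgrad (R : realType) (n : nat) (phi : 'rV[R]_n.+1 -> R)
    (x : 'rV[R]_n.+1) : 'rV[R]_n.+1 :=
  \row_(i < n.+1) 'D_(delta_mx 0 i) (phi \o @retr R n) x.

Definition hessian_defined (R : realType) (n : nat) (phi : 'rV[R]_n.+1 -> R)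
    (x : 'rV[R]_n.+1) : Prop :=
  (\forall y \near x, usphere y -> sdifferentiable (phi : _ -> R^o) y) /\
  sdifferentiable (sgrad phi) x.

Definition gradient_map (R : realType) (n : nat) (phi : 'rV[R]_n.+1 -> R)
    (x : 'rV[R]_n.+1) : 'rV[R]_n.+1 :=
  exps x (sgrad phi x).

Definition self_homeomorphism (T : topologicalType) (A : set T) (f : T -> T) :
    Prop :=
  [/\ set_bij A A f,
      {within A, continuous f} &
      exists2 g : T -> T, {within A, continuous g} &
        forall x, A x -> g (f x) = x].

Definition wrapping (R : realType) (n : nat) (phi : 'rV[R]_n.+1 -> R) : Prop :=
  [/\ c_convex phi,
      finite_set [set x | usphere x /\ ~ hessian_defined phi x],
      forall x, usphere x -> sdifferentiable (phi : _ -> R^o) x &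
      self_homeomorphism (@usphere R n) (gradient_map phi)].

(* The rows of E are an orthonormal basis of T_x, positively oriented for the
   orientation of S^n given by the outward normal x placed first. *)
Definition oriented_frame (R : realType) (n : nat) (x : 'rV[R]_n.+1)
    (E : 'M[R]_(n, n.+1)) : Prop :=
  [/\ E *m E^T = 1%:M, E *m x^T = 0 & 0 < \det (col_mx x E : 'M[R]_(1 + n))].

(* Any two oriented frames at x differ by a rotation of T_x, so the choice does
   not affect [Jac].  A frame exists at each x in S^n if 0 < n; for n = 0 the
   matrix in [Jac] is empty and Jac is 1. *)
Definition frame (R : realType) (n : nat) (x : 'rV[R]_n.+1) : 'M[R]_(n, n.+1) :=
  xget 0 [set E | oriented_frame x E].

(* The (i, j) entry of the matrix is <dG_x(e_i), f_j>, for the frames (e_i) at x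
   and (f_j) at G x: the library's [jacobian] acts on row vectors. *)
Definition Jac (R : realType) (n : nat) (G : 'rV[R]_n.+1 -> 'rV[R]_n.+1)
    (x : 'rV[R]_n.+1) : R :=
  \det (frame x *m jacobian (G \o @retr R n) x *m (frame (G x))^T).

Definition potential (R : realType) (n p : nat)
    (phi : 'I_p -> 'rV[R]_n.+1 -> R) (theta : 'rV[R]_p) (x : 'rV[R]_n.+1) : R :=
  \sum_(i < p) theta 0 i * phi i x.

Definition density (R : realType) (n p : nat)
    (phi : 'I_p -> 'rV[R]_n.+1 -> R) (x : 'rV[R]_n.+1) (theta : 'rV[R]_p) : R :=
  Jac (gradient_map (potential phi theta)) x.

Definition log_concave (R : realType) (p : nat) (Theta : set 'rV[R]_p)
    (L : 'rV[R]_p -> R) : Prop :=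
  (forall theta, Theta theta -> 0 <= L theta) /\
  (forall (theta theta' : 'rV[R]_p) (t : R),
     Theta theta -> Theta theta' -> 0 < t < 1 ->
     L theta `^ (1 - t) * L theta' `^ t <=
       L ((1 - t) *: theta + t *: theta')).

(* Main.v *)
Require Import Defs.
From HB Require Import structures.
From mathcomp Require Import all_boot all_order all_algebra.
From mathcomp Require Import all_classical all_reals all_analysis.
From mathcomp Require Import ring lra.
Import Order.TTheory GRing.Theory Num.Theory.
Import numFieldNormedType.Exports.
Set Implicit Arguments.
Unset Strict Implicit.
Unset Printing Implicit Defensive.
Local Open Scope classical_set_scope.
Local Open Scope ring_scope.

(** Fix a data point x.  The value of the likelihood at x depends on theta only
    through the gradient v and the Hessian of phi_theta at x, both of which are
    linear in theta, so it is enough to see how the Jacobian depends on them.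

    Contact.  If phi is c-convex then, by compactness of the sphere, some y
    makes z |-> phi z + c(z, y) minimal at z = x ([c_convex_contact]).  This y
    is not antipodal to x, because c(., -x) has a downward conical point at x,
    which a differentiable phi cannot compensate ([contact_not_antipodal]).
    The first order condition then reads |v| = d(x, y) < pi and y = exp_x v,
    and the second order condition says that Hess phi + B(v) is nonnegative on
    T_x, where B(v) is the Hessian of c(., exp_x v) at x
    ([contact_conditions]).  Explicitly, with r = |v|,
    B(v)(xi) = |xi|^2 - (|v|^2 |xi|^2 - <v, xi>^2) / q(r),
    where q(r) = r^2 sin r / (sin r - r cos r).

    Factorization.  The differential of G_phi at x is Hess phi + B(v) followed
    by the differential of exp_x at v ([exps_diff_factor]), and the latter has
    determinant (sin r / r)^(dim - 1) ([det_transport]).  Hence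
    Jac G_phi = (sin r / r)^(dim - 1) det (Hess phi + B(v))
    ([Jac_gradient_map]), where Hess phi + B(v) is symmetric
    ([dgrad_sym]) and positive semidefinite.

    Concavity.  Three facts remain.  First, v |-> sin |v| / |v| is log-concave
    on |v| < pi ([sinc_log_concave]).  Second, v |-> B(v)(xi) is concave there
    ([cost_hess_concave]); this is the nonnegative cross-curvature of the
    sphere.  A nonnegative quadratic form divided by a positive concave
    function is convex, so all comes down to the concavity and monotonicity of
    q on (0, pi) ([cost_ratio_concave], [cost_ratio_nincr]).  Third, if a
    positive semidefinite form dominates a convex combination of two others,
    then its determinant dominates the corresponding weighted geometric mean
    ([det_log_concave]): the determinant is a product of Schur complements,
    each of which is a minimum of values of the form, hence concave and
    monotone in it.  The product over the data points inherits
    log-concavity. *)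

(** * Mean value and derivative rules in one variable *)

Section MeanValue.
Variable R : realType.
Implicit Types (f df : R -> R) (a b : R).

Lemma is_derive_cvg f (x d : R) : is_derive x 1 f d -> f @ x --> f x.
Proof.
by move=> h; apply: differentiable_continuous; apply/derivable1_diffP; case: h.
Qed.

Lemma mean_value_cont f df a b : a < b ->
  (forall z : R, a <= z <= b -> {for z, continuous f}) ->
  (forall z : R, a < z < b -> is_derive z 1 f (df z)) ->
  exists2 c, a < c < b & f b - f a = df c * (b - a).
Proof.
move=> ab fc fd.
have fd' (z : R) : z \in `]a, b[ -> is_derive z 1 f (df z).
  by rewrite in_itv/=; exact: fd.
have fc' : {within `[a, b], continuous f}.
  by apply: continuous_in_subspaceT => z; rewrite inE/= in_itv/=; exact: fc.
by have [c] := MVT ab fd' fc'; rewrite in_itv/= => ? ?; exists c.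
Qed.

Lemma mean_value f df a b : a < b ->
  (forall x, a <= x <= b -> is_derive x 1 f (df x)) ->
  exists2 c, a < c < b & f b - f a = df c * (b - a).
Proof.
move=> ab fd; apply: mean_value_cont => // z zab.
  exact: is_derive_cvg (fd z zab).
by case/andP: zab => az zb; apply: fd; rewrite !ltW.
Qed.

Lemma le_of_derive_ge0 f df a b : a <= b ->
  (forall x, a <= x <= b -> is_derive x 1 f (df x)) ->
  (forall x, a < x < b -> 0 <= df x) -> f a <= f b.
Proof.
rewrite le_eqVlt => /predU1P[->//|ab] h h0.
have [c cab E] := mean_value ab h.
by rewrite -subr_ge0 E mulr_ge0 ?h0// subr_ge0 ltW.
Qed.

Lemma ge0_of_derive_ge0 f df b : (forall x : R, is_derive x 1 f (df x)) ->
  0 <= b -> f 0 = 0 -> (forall x, 0 < x < b -> 0 <= df x) -> 0 <= f b.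
Proof.
move=> h b0 f0 h0; rewrite -[leLHS]f0.
exact: (@le_of_derive_ge0 f df 0 b b0 (fun x _ => h x) h0).
Qed.

End MeanValue.

(** The rules below restate the differentiation rules for functions written
    pointwise, the form that the tactic [deriv] matches syntactically. *)
Section ScalarDerivatives.
Variable R : realType.
Implicit Types (f g : R -> R) (x a b : R).

Lemma is_derive_cstS (c x : R) : is_derive x 1 (fun _ : R => c) 0.
Proof. exact: is_derive_cst. Qed.

Lemma is_derive_idS x : is_derive x 1 (fun y : R => y) 1.
Proof. exact: is_derive_id. Qed.

Lemma is_derive_addS f g x a b : is_derive x 1 f a -> is_derive x 1 g b ->
  is_derive x 1 (fun y => f y + g y) (a + b).
Proof. exact: is_deriveD. Qed.

Lemma is_derive_oppS f x a : is_derive x 1 f a ->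
  is_derive x 1 (fun y => - f y) (- a).
Proof. exact: is_deriveN. Qed.

Lemma is_derive_mulS f g x a b : is_derive x 1 f a -> is_derive x 1 g b ->
  is_derive x 1 (fun y => f y * g y) (f x * b + g x * a).
Proof. exact: is_deriveM. Qed.

Lemma is_derive_expS f n x a : is_derive x 1 f a ->
  is_derive x 1 (fun y => f y ^+ n.+1) (n.+1%:R * f x ^+ n * a).
Proof.
move=> h; have -> : (fun y => f y ^+ n.+1) = f ^+ n.+1.
  by apply/funext => y; rewrite exprfctE.
exact: is_deriveX.
Qed.

Lemma is_derive_invS f x a : f x != 0 -> is_derive x 1 f a ->
  is_derive x 1 (fun y => (f y)^-1) (- (f x) ^- 2 * a).
Proof. exact: is_deriveV. Qed.

Lemma is_derive_sinS f x a : is_derive x 1 f a ->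
  is_derive x 1 (fun y => sin (f y)) (cos (f x) * a).
Proof. by move=> h; exact: is_derive1_comp. Qed.

Lemma is_derive_cosS f x a : is_derive x 1 f a ->
  is_derive x 1 (fun y => cos (f y)) (- sin (f x) * a).
Proof. by move=> h; exact: is_derive1_comp. Qed.

End ScalarDerivatives.

(** Typeclass resolution is switched off so that it does not solve a subgoal
    with a derivative of its own choosing, and so that hypotheses on the
    functions at hand take precedence over the rules. *)
Ltac deriv := notypeclasses refine (is_derive_eq _ _); [repeat first
  [ eassumption
  | notypeclasses refine (is_derive_cstS _ _)
  | notypeclasses refine (is_derive_idS _)
  | notypeclasses refine (is_derive_addS _ _)
  | notypeclasses refine (is_derive_oppS _)
  | notypeclasses refine (is_derive_mulS _ _)
  | notypeclasses refine (is_derive_expS _ _)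
  | notypeclasses refine (is_derive_sinS _)
  | notypeclasses refine (is_derive_cosS _)
  | notypeclasses refine (is_derive_invS _ _) ] | cbv beta ].

(** * The ratio q(r) = r^2 sin r / (sin r - r cos r) *)

Section Trig.
Variable R : realType.
Implicit Types r x : R.

(** Writing P for [sin_defect] and M for [slope_num], the ratio q =
    [cost_ratio] satisfies q' = - r M / P^2 and q'' = - [bend_num] / P^3.
    The names with a prime are the derivatives. *)
Definition sin_defect r : R := sin r - r * cos r.
Definition slope_num r : R := r ^+ 2 + r * (sin r * cos r) - 2 * sin r ^+ 2.
Definition slope_num' r : R := 3 * r - 3 * (sin r * cos r) - 2 * (r * sin r ^+ 2).
Definition bend_num r : R := (slope_num r + r * slope_num' r) * sin_defect r
  - 2 * (r ^+ 2 * sin r * slope_num r).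
Definition bend_num' r : R :=
  (2 * slope_num' r + r * (4 * (sin r * sin_defect r))) * sin_defect r
  + (slope_num r + r * slope_num' r) * (r * sin r)
  - 2 * ((2 * r * sin r + r ^+ 2 * cos r) * slope_num r
         + r ^+ 2 * sin r * slope_num' r).
Definition cost_ratio r : R := r ^+ 2 * sin r / sin_defect r.

Lemma is_derive_sin_defect r : is_derive r 1 sin_defect (r * sin r).
Proof. by rewrite /sin_defect; deriv; ring. Qed.

Lemma is_derive_slope_num r : is_derive r 1 slope_num (slope_num' r).
Proof.
rewrite /slope_num /slope_num'; deriv.
have e := sin2cos2 r; ring: e.
Qed.

Lemma is_derive_slope_num' r : is_derive r 1 slope_num' (4 * (sin r * sin_defect r)).
Proof.
rewrite /slope_num' /sin_defect; deriv.
have e := sin2cos2 r; ring: e.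
Qed.

Lemma sin_defect_gt0 r : 0 < r < pi -> 0 < sin_defect r.
Proof.
move=> /andP[r0 rpi].
have [|c /andP[c0 cr]] := mean_value r0 (f := sin_defect) (df := fun x => x * sin x).
  by move=> x _; exact: is_derive_sin_defect.
rewrite {2}/sin_defect sin0 mul0r !subr0 => ->.
by rewrite !mulr_gt0// sin_gt0_pi// c0 (lt_trans cr).
Qed.

Lemma sin_defect_ge0 r : 0 <= r <= pi -> 0 <= sin_defect r.
Proof.
move=> /andP[r0 rpi]; apply: (ge0_of_derive_ge0 is_derive_sin_defect) => //.
  by rewrite /sin_defect sin0 mul0r subr0.
move=> x /andP[x0 xr]; rewrite mulr_ge0 ?ltW// sin_gt0_pi// x0.
exact: lt_le_trans rpi.
Qed.

Lemma sin_le r : 0 <= r -> sin r <= r.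
Proof.
move=> r0; rewrite -subr_ge0.
have d (x : R) : is_derive x 1 (fun r => r - sin r) (1 - cos x) by deriv; ring.
apply: (ge0_of_derive_ge0 d r0); first by rewrite sin0 subr0.
by move=> x _; rewrite subr_ge0 cos_le1.
Qed.

Lemma slope_num'_ge0 r : 0 <= r <= pi -> 0 <= slope_num' r.
Proof.
move=> /andP[r0 rpi]; apply: (ge0_of_derive_ge0 is_derive_slope_num') => //.
  by rewrite /slope_num' sin0; ring.
move=> x /andP[x0 xr].
have xpi : 0 <= x <= pi by rewrite ltW// ltW// (lt_le_trans xr).
by rewrite !mulr_ge0 ?sin_ge0_pi ?sin_defect_ge0.
Qed.

Lemma slope_num_ge0 r : 0 <= r <= pi -> 0 <= slope_num r.
Proof.
move=> /andP[r0 rpi]; apply: (ge0_of_derive_ge0 is_derive_slope_num) => //.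
  by rewrite /slope_num sin0; ring.
move=> x /andP[x0 xr]; apply: slope_num'_ge0.
by rewrite ltW// ltW// (lt_le_trans xr).
Qed.

Lemma slope_num'_le r : 0 <= r <= pi -> slope_num' r <= 8 * sin_defect r.
Proof.
move=> /andP[r0 rpi]; rewrite -subr_ge0.
have d (x : R) : is_derive x 1 (fun r => 8 * sin_defect r - slope_num' r)
    (4 * sin x * (2 * x - sin_defect x)).
  have h := is_derive_sin_defect x; have h' := is_derive_slope_num' x.
  by deriv; ring.
apply: (ge0_of_derive_ge0 d) => //.
  by rewrite /slope_num' /sin_defect sin0; ring.
move=> x /andP[x0 xr].
have xpi : 0 <= x <= pi by rewrite ltW// ltW// (lt_le_trans xr).
rewrite !mulr_ge0 ?sin_ge0_pi// subr_ge0 /sin_defect.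
have := sin_le (ltW x0); have := cos_geN1 x.
by move: (cos x) (sin x) => c s; nra.
Qed.

(** A crude bound, but enough for [bend_num] / (r P) to be at least - 16 r^3,
    hence to have a nonnegative lower limit at 0. *)
Lemma slope_num_le r : 0 <= r <= pi -> slope_num r <= 8 * (r * sin_defect r).
Proof.
move=> /andP[r0 rpi]; rewrite -subr_ge0.
have d (x : R) : is_derive x 1 (fun r => 8 * (r * sin_defect r) - slope_num r)
    (8 * sin_defect x - slope_num' x + 8 * (x * (x * sin x))).
  have h := is_derive_sin_defect x; have h' := is_derive_slope_num x.
  by deriv; ring.
apply: (ge0_of_derive_ge0 d) => //.
  by rewrite /slope_num /sin_defect sin0; ring.
move=> x /andP[x0 xr].
have xpi : 0 <= x <= pi by rewrite ltW// ltW// (lt_le_trans xr).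
by rewrite addr_ge0 ?subr_ge0 ?slope_num'_le// !mulr_ge0 ?sin_ge0_pi// ltW.
Qed.

Lemma is_derive_cost_ratio r : 0 < r < pi ->
  is_derive r 1 cost_ratio (- (r * slope_num r) / sin_defect r ^+ 2).
Proof.
move=> /sin_defect_gt0 P0; rewrite /cost_ratio.
have h := is_derive_sin_defect r; have Pn0 : sin_defect r != 0 by rewrite gt_eqF.
deriv => //.
have e := sin2cos2 r; move: Pn0; rewrite /slope_num /sin_defect => Pn0; field: e.
by [].
Qed.

Lemma is_derive_bend_num r : is_derive r 1 bend_num (bend_num' r).
Proof.
have hP := is_derive_sin_defect r; have hM := is_derive_slope_num r.
have hM' := is_derive_slope_num' r.
by rewrite /bend_num /bend_num'; deriv; ring.
Qed.

(** The derivative of [bend_num] / (r P) is a sum of squares over (r P)^2.  It comes from the Riccati equation r q' = 3 q - q^2 - r^2: for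
    w = (1 - q) q' - r, which has the sign of q'', it gives
    w' = 2 (1 - q) w / r - (1 + q'^2), a linear equation with integrating
    factor (P / r)^2. *)
Lemma bend_num_wronskian r :
  bend_num' r * (r * sin_defect r) - bend_num r * (sin_defect r + r * (r * sin r)) =
  2 * (sin_defect r ^+ 4 + r ^+ 2 * slope_num r ^+ 2).
Proof.
have e := sin2cos2 r.
rewrite /bend_num /bend_num' /slope_num' /slope_num /sin_defect; ring: e.
Qed.

Lemma is_derive_cost_slope r : 0 < r < pi ->
  is_derive r 1 (fun x => - (x * slope_num x) / sin_defect x ^+ 2)
    (- bend_num r / sin_defect r ^+ 3).
Proof.
move=> /sin_defect_gt0 P0.
have h := is_derive_sin_defect r; have h' := is_derive_slope_num r.
have Pn0 : sin_defect r != 0 by rewrite gt_eqF.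
deriv; rewrite ?expf_neq0// /bend_num.
by field.
Qed.

Lemma bend_num_ge r : 0 < r < pi -> - (16 * r ^+ 3) * (r * sin_defect r) <= bend_num r.
Proof.
move=> r0pi; have /andP[r0 rpi] := r0pi.
have rpi' : 0 <= r <= pi by rewrite !ltW.
have M0 := slope_num_ge0 rpi'; have M'0 := slope_num'_ge0 rpi'; have P0 := sin_defect_ge0 rpi'.
have s0 := sin_ge0_pi rpi'; have sr := sin_le (ltW r0); have M8 := slope_num_le rpi'.
rewrite /bend_num -subr_ge0.
have -> : (slope_num r + r * slope_num' r) * sin_defect r - 2 * (r ^+ 2 * sin r * slope_num r)
    - - (16 * r ^+ 3) * (r * sin_defect r) =
  (slope_num r + r * slope_num' r) * sin_defect r +
  2 * r ^+ 2 * (sin r * (8 * (r * sin_defect r) - slope_num r)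
     + 8 * ((r - sin r) * (r * sin_defect r))) by ring.
have r0' := ltW r0.
apply: addr_ge0; first by rewrite mulr_ge0// addr_ge0// mulr_ge0.
have h1 : 0 <= sin r * (8 * (r * sin_defect r) - slope_num r) by rewrite mulr_ge0// subr_ge0.
have h2 : 0 <= (r - sin r) * (r * sin_defect r) by rewrite !mulr_ge0// subr_ge0.
by apply: mulr_ge0; [rewrite mulr_ge0// sqr_ge0|lra].
Qed.

(** The quotient [bend_num] / (r P) increases and its lower limit at 0 is
    nonnegative. *)
Lemma bend_num_ge0 r : 0 < r < pi -> 0 <= bend_num r.
Proof.
move=> r0pi; have /andP[r0 rpi] := r0pi.
pose g x := bend_num x / (x * sin_defect x).
have P0 x : 0 < x <= r -> 0 < x * sin_defect x.
  move=> /andP[x0 xr]; rewrite mulr_gt0// sin_defect_gt0// x0.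
  exact: le_lt_trans rpi.
have g_mono x : 0 < x <= r -> g x <= g r.
  move=> /andP[x0 xr].
  have d (y : R) : x <= y <= r -> is_derive y 1 g
      (2 * (sin_defect y ^+ 4 + y ^+ 2 * slope_num y ^+ 2) / (y * sin_defect y) ^+ 2).
    move=> /andP[xy yr]; have y0 := lt_le_trans x0 xy.
    have yP0 : y * sin_defect y != 0 by rewrite gt_eqF// P0// y0.
    have hP := is_derive_sin_defect y; have hT := is_derive_bend_num y.
    rewrite -bend_num_wronskian /g; deriv => //.
    by field; move: yP0; rewrite mulf_eq0 negb_or => /andP[-> ->].
  apply: (le_of_derive_ge0 xr d) => y _; rewrite divr_ge0 ?sqr_ge0//.
  apply: mulr_ge0 => //; apply: addr_ge0; first exact: exprn_even_ge0.
  by rewrite -exprMn sqr_ge0.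
have g_lb x : 0 < x <= r -> - (16 * x ^+ 3) <= g x.
  move=> xr; rewrite ler_pdivlMr ?P0//; apply: bend_num_ge.
  by case/andP: xr => -> /= /le_lt_trans; exact.
suff g0 : 0 <= g r by rewrite -[bend_num r](divfK (lt0r_neq0 (P0 r _)))
  ?r0 ?lexx// mulr_ge0// ltW// P0// r0 lexx.
rewrite leNgt; apply/negP => gr.
(* At this point x the lower bound - 16 x^3 exceeds g r, because
   16 x^3 <= 16 x <= - g r / 2. *)
pose x := Num.min r (Num.min 1 (- g r / 32)).
have x0 : 0 < x by rewrite !lt_min r0 ltr01/= divr_gt0// oppr_gt0.
have xr : x <= r by rewrite ge_min lexx.
have x1 : x <= 1 by rewrite !ge_min lexx orbT.
have xg : x <= - g r / 32 by rewrite !ge_min lexx !orbT.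
have := le_trans (g_lb x _) (g_mono x _); rewrite x0 xr => /(_ isT isT).
have : x ^+ 3 <= x by rewrite -[leRHS]expr1 ler_wiXn2l// ltW.
lra.
Qed.

Lemma cost_ratio_gt0 r : 0 < r < pi -> 0 < cost_ratio r.
Proof.
move=> h; rewrite divr_gt0 ?sin_defect_gt0// mulr_gt0 ?sin_gt0_pi//.
by rewrite exprn_gt0//; case/andP: h.
Qed.

Lemma cost_ratio_nincr x y : 0 < x -> x <= y -> y < pi -> cost_ratio y <= cost_ratio x.
Proof.
move=> x0 xy ypi; rewrite -lerN2.
have d (z : R) : x <= z <= y ->
    is_derive z 1 (fun r => - cost_ratio r) (z * slope_num z / sin_defect z ^+ 2).
  move=> /andP[xz zy]; have zpi : 0 < z < pi.
    by rewrite (lt_le_trans x0 xz) (le_lt_trans zy ypi).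
  by have h := is_derive_cost_ratio zpi; deriv; rewrite mulNr opprK.
apply: (le_of_derive_ge0 xy d) => z /andP[xz zy].
have z0 := lt_trans x0 xz.
rewrite divr_ge0 ?sqr_ge0// mulr_ge0 ?(ltW z0)// slope_num_ge0// (ltW z0).
by rewrite ltW// (lt_trans zy).
Qed.

Lemma cost_slope_nincr x y : 0 < x -> x <= y -> y < pi ->
  - (y * slope_num y) / sin_defect y ^+ 2 <= - (x * slope_num x) / sin_defect x ^+ 2.
Proof.
move=> x0 xy ypi; rewrite -lerN2.
have d (z : R) : x <= z <= y ->
    is_derive z 1 (fun r => - (- (r * slope_num r) / sin_defect r ^+ 2))
      (bend_num z / sin_defect z ^+ 3).
  move=> /andP[xz zy]; have zpi : 0 < z < pi.
    by rewrite (lt_le_trans x0 xz) (le_lt_trans zy ypi).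
  by have h := is_derive_cost_slope zpi; deriv; rewrite mulNr opprK.
apply: (le_of_derive_ge0 xy d) => z /andP[xz zy].
have zpi : 0 < z < pi by rewrite (lt_trans x0 xz) (lt_trans zy ypi).
by rewrite divr_ge0 ?bend_num_ge0// exprn_ge0// ltW ?sin_defect_gt0.
Qed.

End Trig.

(** * Concavity of q and log-concavity of sin r / r *)

Section Concave.
Variable R : realType.
Implicit Types (f df : R -> R) (r x y t : R).

Lemma concave_of_derive f df x y t : x <= y ->
  (forall z : R, x <= z <= y -> {for z, continuous f}) ->
  (forall z : R, x < z < y -> is_derive z 1 f (df z)) ->
  (forall u w, x < u -> u <= w -> w < y -> df w <= df u) ->
  0 <= t <= 1 -> (1 - t) * f x + t * f y <= f ((1 - t) * x + t * y).
Proof.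
rewrite le_eqVlt => /predU1P[<-|xy] fc fd dfm /andP[].
  by move=> _ _; rewrite -!mulrDl subrK !mul1r.
rewrite le_eqVlt => /predU1P[<-|t0]; first by rewrite subr0 !mul0r !mul1r !addr0.
rewrite le_eqVlt => /predU1P[->|t1]; first by rewrite subrr !mul0r !mul1r !add0r.
set z := _ + t * y.
have xz : x < z by rewrite /z -subr_gt0; nra.
have zy : z < y by rewrite /z -subr_gt0; nra.
have mvt a b : x <= a -> a < b -> b <= y ->
    exists2 c, a < c < b & f b - f a = df c * (b - a).
  move=> xa ab yb; apply: mean_value_cont => // w /andP[aw wb].
    by apply: fc; rewrite (le_trans xa)//= (le_trans wb).
  by apply: fd; rewrite (le_lt_trans xa)// (lt_le_trans wb).
have [c1 /andP[xc1 c1z] E1] := mvt x z (lexx x) xz (ltW zy).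
have [c2 /andP[zc2 c2y] E2] := mvt z y (ltW xz) zy (lexx y).
have c12 : df c2 <= df c1 by apply: dfm => //; rewrite ltW// (lt_trans c1z).
have E : f z - ((1 - t) * f x + t * f y) = (1 - t) * t * (y - x) * (df c1 - df c2).
  transitivity ((1 - t) * (f z - f x) - t * (f y - f z)); first by ring.
  by rewrite E1 E2 /z; ring.
by rewrite -subr_ge0 E !mulr_ge0 ?subr_ge0// ltW.
Qed.

(** The point rt may lie below the convex combination of r0 and r1: this is
    what the triangle inequality gives for the norms of vectors, and q is
    nonincreasing. *)
Lemma cost_ratio_concave r0 r1 rt t : 0 < r0 < pi -> 0 < r1 < pi -> 0 <= t <= 1 ->
  0 < rt -> rt <= (1 - t) * r0 + t * r1 ->
  (1 - t) * cost_ratio r0 + t * cost_ratio r1 <= cost_ratio rt.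
Proof.
wlog r01 : r0 r1 t / r0 <= r1.
  move=> H h0 h1 t01 rt0 rtle; have [r01|/ltW r10] := leP r0 r1; first exact: H.
  rewrite addrC; have := H r1 r0 (1 - t) r10 h1 h0.
  rewrite subKr; apply => //; last by rewrite addrC.
  by case/andP: t01 => ? ?; rewrite subr_ge0 gerBl; apply/andP.
move=> /andP[r0p r0pi] /andP[r1p r1pi] /andP[t0 t1] rt0 rtle.
have d (z : R) : 0 < z < pi -> is_derive z 1 (@cost_ratio R)
    (- (z * slope_num z) / sin_defect z ^+ 2).
  exact: is_derive_cost_ratio.
apply: (@le_trans _ _ (cost_ratio ((1 - t) * r0 + t * r1))).
  apply: (concave_of_derive (df := fun z => - (z * slope_num z) / sin_defect z ^+ 2)) => //.
  - move=> z /andP[z0 z1]; apply: is_derive_cvg; apply: d.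
    by rewrite (lt_le_trans r0p)// (le_lt_trans z1).
  - by move=> z /andP[z0 z1]; apply: d; rewrite (lt_trans r0p) ?(lt_trans z1).
  - move=> u w u0 uw wr; apply: cost_slope_nincr => //; first exact: lt_trans u0.
    exact: lt_trans r1pi.
  - by rewrite t0.
apply: cost_ratio_nincr => //.
have : (1 - t) * r0 + t * r1 <= r1 by rewrite -subr_ge0; nra.
by move/le_lt_trans; apply.
Qed.

Definition sinc r : R := if r == 0 then 1 else sin r / r.

Lemma sinc0 : sinc 0 = 1.
Proof. by rewrite /sinc eqxx. Qed.

Lemma sincE r : r != 0 -> sinc r = sin r / r.
Proof. by rewrite /sinc => /negbTE ->. Qed.

Lemma sinc_gt0 r : 0 <= r < pi -> 0 < sinc r.
Proof.
move=> /andP[]; rewrite le_eqVlt => /predU1P[<-|r0] rpi; first by rewrite sinc0.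
by rewrite sincE ?gt_eqF// divr_gt0// sin_gt0_pi// r0.
Qed.

Lemma sinc_continuous : continuous sinc.
Proof.
move=> x; have [->|x0] := eqVneq x 0.
  apply/continuous_withinNx; rewrite sinc0.
  have [/cvg_ex[l sl] sE] := is_derive_sin (0 : R).
  have : l = 1 by rewrite -(cvg_lim _ sl)// -[RHS]cos0 -sE.
  move=> l1; move: sl; rewrite l1; apply: cvg_trans.
  apply: near_eq_cvg; near=> h.
  have h0 : h != 0 by near: h; exact: nbhs_dnbhs_neq.
  by rewrite sincE// /GRing.scale/= mulr1 addr0 sin0 subr0 mulrC.
have : {for x, continuous (fun r => sin r / r)}.
  apply: continuousM; first exact: continuous_sin.
  exact: continuousV.
rewrite /prop_for /continuous_at -(sincE x0); apply: cvg_trans.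
apply: near_eq_cvg; near=> h; rewrite sincE//.
by near: h; exact: open_neq.
Unshelve. all: by end_near. Qed.

(** The logarithmic derivative of sin r / r is - r / q(r), so its monotonicity
    follows from that of q. *)
Lemma is_derive_ln_sinc r : 0 < r < pi ->
  is_derive r 1 (fun r => ln (sinc r)) (- (r / cost_ratio r)).
Proof.
move=> rpi; have /andP[r0 _] := rpi.
have s0 := sin_gt0_pi rpi.
have h : is_derive r 1 (fun r : R => sin r / r) ((r * cos r - sin r) / r ^+ 2).
  by deriv; [exact: lt0r_neq0|field; exact: lt0r_neq0].
have h' : is_derive r 1 sinc ((r * cos r - sin r) / r ^+ 2).
  move: h; apply: near_eq_is_derive.
  near=> z; rewrite sincE// gt_eqF//; near: z; exact: lt_nbhsr.
have sr : 0 < sinc r by apply: sinc_gt0; case/andP: rpi => /ltW -> ->.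
refine (is_derive_eq (is_derive1_comp (is_derive1_ln sr) h') _).
have := sin_defect_gt0 rpi; rewrite sincE ?gt_eqF// /cost_ratio /sin_defect => P0.
by field; rewrite !gt_eqF.
Unshelve. all: by end_near. Qed.

Lemma sinc_log_concave r0 r1 rt t : 0 <= r0 < pi -> 0 <= r1 < pi ->
  0 <= t <= 1 -> 0 <= rt -> rt <= (1 - t) * r0 + t * r1 ->
  sinc r0 `^ (1 - t) * sinc r1 `^ t <= sinc rt.
Proof.
wlog r01 : r0 r1 t / r0 <= r1.
  move=> H h0 h1 t01 rt0 rtle; have [r01|/ltW r10] := leP r0 r1; first exact: H.
  rewrite mulrC; have := H r1 r0 (1 - t) r10 h1 h0.
  rewrite subKr; apply => //; last by rewrite addrC.
  by case/andP: t01 => ? ?; rewrite subr_ge0 gerBl; apply/andP.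
move=> /andP[r0p r0pi] /andP[r1p r1pi] /andP[t0 t1] rt0 rtle.
set rho := _ + t * r1 in rtle.
have rho1 : rho <= r1 by rewrite -subr_ge0 /rho; nra.
have rhopi := le_lt_trans rho1 r1pi; have rtpi := le_lt_trans rtle rhopi.
have rho0 := le_trans rt0 rtle.
have s0 : 0 < sinc r0 by rewrite sinc_gt0// r0p.
have s1 : 0 < sinc r1 by rewrite sinc_gt0// r1p.
have st : 0 < sinc rt by rewrite sinc_gt0// rt0.
rewrite -ler_ln ?posrE ?mulr_gt0 ?powR_gt0//.
rewrite lnM ?posrE ?powR_gt0// !ln_powR.
have c z : 0 <= z <= r1 -> {for z, continuous (fun r => ln (sinc r))}.
  move=> /andP[z0 z1]; apply: continuous_comp; first exact: sinc_continuous.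
  by apply: continuous_ln; rewrite sinc_gt0// z0 (le_lt_trans z1).
have m u w : 0 < u -> u <= w -> w < r1 -> - (w / cost_ratio w) <= - (u / cost_ratio u).
  move=> u0 uw wr; have wpi := lt_trans wr r1pi.
  have w0 := lt_le_trans u0 uw.
  have Qw : 0 < cost_ratio w by rewrite cost_ratio_gt0// w0.
  have Qu : 0 < cost_ratio u by rewrite cost_ratio_gt0// u0 (le_lt_trans uw).
  rewrite lerN2; apply: ler_pM => //; rewrite ?invr_ge0 ?(ltW u0) ?(ltW Qu)//.
  by rewrite lef_pV2 ?posrE//; exact: cost_ratio_nincr.
have d z : 0 < z < r1 -> is_derive z 1 (fun r => ln (sinc r)) (- (z / cost_ratio z)).
  by move=> /andP[z0 z1]; apply: is_derive_ln_sinc; rewrite z0 (lt_trans z1).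
apply: (@le_trans _ _ (ln (sinc rho))).
  apply: (concave_of_derive (f := fun r => ln (sinc r))
    (df := fun z => - (z / cost_ratio z))) => //.
  - by move=> z /andP[z0 z1]; apply: c; rewrite (le_trans r0p).
  - by move=> z /andP[z0 z1]; apply: d; rewrite (le_lt_trans r0p).
  - by move=> u w u0; apply: m; rewrite (le_lt_trans r0p).
  - by rewrite t0.
move: rtle; rewrite le_eqVlt => /predU1P[->//|rtrho].
have c' z : rt <= z <= rho -> {for z, continuous (fun r => ln (sinc r))}.
  by move=> /andP[z0 z1]; apply: c; rewrite (le_trans rt0)// (le_trans z1).
have d' (z : R) : rt < z < rho ->
    is_derive z 1 (fun r => ln (sinc r)) (- (z / cost_ratio z)).
  by move=> /andP[z0 z1]; apply: d; rewrite (le_lt_trans rt0)// (lt_le_trans z1).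
have [z /andP[z0 z1] E] := mean_value_cont rtrho c' d'.
rewrite -subr_le0 E mulNr oppr_le0 mulr_ge0//; last by rewrite subr_ge0 ltW.
have zp := le_lt_trans rt0 z0.
by rewrite divr_ge0// ltW// cost_ratio_gt0// zp (lt_trans z1).
Qed.

End Concave.

(** * The Euclidean inner product *)

Section Euclid.
Variables (R : realType) (m : nat).
Implicit Types (u v w xi : 'rV[R]_m) (a t : R).

Lemma dotpE u v : dotp u v = \sum_i u 0 i * v 0 i.
Proof. by rewrite /dotp mxE; apply: eq_bigr => i _; rewrite mxE. Qed.

Lemma dotpC u v : dotp u v = dotp v u.
Proof. by rewrite !dotpE; apply: eq_bigr => i _; rewrite mulrC. Qed.

Lemma dotpDl u v w : dotp (u + v) w = dotp u w + dotp v w.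
Proof. by rewrite /dotp mulmxDl mxE. Qed.

Lemma dotpZl a u v : dotp (a *: u) v = a * dotp u v.
Proof. by rewrite /dotp -scalemxAl mxE. Qed.

Lemma dotpDr u v w : dotp u (v + w) = dotp u v + dotp u w.
Proof. by rewrite ![dotp u _]dotpC dotpDl. Qed.

Lemma dotpZr a u v : dotp u (a *: v) = a * dotp u v.
Proof. by rewrite ![dotp u _]dotpC dotpZl. Qed.

Lemma dotpNl u v : dotp (- u) v = - dotp u v.
Proof. by rewrite -scaleN1r dotpZl mulN1r. Qed.

Lemma dotpNr u v : dotp u (- v) = - dotp u v.
Proof. by rewrite -scaleN1r dotpZr mulN1r. Qed.

Lemma dotp0l v : dotp 0 v = 0.
Proof. by rewrite /dotp mul0mx mxE. Qed.

Lemma dotp0r v : dotp v 0 = 0.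
Proof. by rewrite dotpC dotp0l. Qed.

Definition dotp_lin := (dotpDl, dotpDr, dotpZl, dotpZr, dotpNl, dotpNr, dotp0l, dotp0r).

Lemma dotp_ge0 v : 0 <= dotp v v.
Proof. by rewrite dotpE sumr_ge0// => i _; rewrite -expr2 sqr_ge0. Qed.

Lemma dotp_eq0 v : dotp v v = 0 -> v = 0.
Proof.
move=> /eqP; rewrite dotpE psumr_eq0 => [/allP h|i _]; last by rewrite -expr2 sqr_ge0.
apply/rowP => i; rewrite mxE; apply/eqP.
by have := h i (mem_index_enum i); rewrite -expr2 sqrf_eq0.
Qed.

Lemma dotp_gt0 v : v != 0 -> 0 < dotp v v.
Proof.
by move=> v0; rewrite lt0r dotp_ge0 andbT; apply: contra_neq v0; exact: dotp_eq0.
Qed.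

Lemma enorm_ge0 v : 0 <= enorm v.
Proof. exact: sqrtr_ge0. Qed.

Lemma enorm_sqr v : enorm v ^+ 2 = dotp v v.
Proof. by rewrite sqr_sqrtr// dotp_ge0. Qed.

Lemma enorm0 : enorm (0 : 'rV[R]_m) = 0.
Proof. by rewrite /enorm dotp0l sqrtr0. Qed.

Lemma enorm_gt0 v : v != 0 -> 0 < enorm v.
Proof. by move=> v0; rewrite sqrtr_gt0 dotp_gt0. Qed.

Lemma enormZ a v : enorm (a *: v) = `|a| * enorm v.
Proof.
by rewrite /enorm dotpZl dotpZr mulrA -expr2 sqrtrM ?sqr_ge0// sqrtr_sqr.
Qed.

Lemma cauchy_schwarz u v : dotp u v ^+ 2 <= dotp u u * dotp v v.
Proof.
have [->|v0] := eqVneq v 0; first by rewrite !dotp0r expr0n mulr0.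
have vv := dotp_gt0 v0.
have := dotp_ge0 (dotp v v *: u - dotp u v *: v).
rewrite !dotp_lin [dotp v u]dotpC.
move: (dotp u u) (dotp u v) (dotp v v) vv => a b c c0.
move=> h; have : 0 <= c * (a * c - b ^+ 2) by apply: le_trans h _; lra.
by rewrite pmulr_rge0// subr_ge0.
Qed.

Lemma dotp_le_enorm u v : dotp u v <= enorm u * enorm v.
Proof.
apply: le_trans (ler_norm _) _.
rewrite -(@ler_pXn2r _ 2)// ?nnegrE ?mulr_ge0 ?enorm_ge0//.
by rewrite exprMn !enorm_sqr -normrX ger0_norm ?sqr_ge0// cauchy_schwarz.
Qed.

Lemma ler_enormD u v : enorm (u + v) <= enorm u + enorm v.
Proof.
rewrite -(@ler_pXn2r _ 2)// ?nnegrE ?addr_ge0 ?enorm_ge0//.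
rewrite enorm_sqr !dotp_lin [dotp v u]dotpC sqrrD !enorm_sqr.
have := dotp_le_enorm u v; lra.
Qed.

Lemma dotp_suml q (F : 'I_q -> 'rV[R]_m) v :
  dotp (\sum_i F i) v = \sum_i dotp (F i) v.
Proof. by rewrite /dotp mulmx_suml summxE. Qed.

End Euclid.

(** * Concavity of the Hessian of the cost *)

Section CurvatureForm.
Variables (R : realType) (m : nat).
Implicit Types (u v w xi : 'rV[R]_m) (a t : R).

Definition perp_form xi v w := dotp v w * dotp xi xi - dotp v xi * dotp w xi.

Lemma perp_form_ge0 xi v : 0 <= perp_form xi v v.
Proof. by rewrite subr_ge0 -expr2 cauchy_schwarz. Qed.

(** The Hessian of z |-> c(z, exp_x v) at x, as a quadratic form in xi.  At
    v = 0 the quotient is 0 / 0 = 0, which gives the correct value |xi|^2. *)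
Definition cost_hess v xi :=
  dotp xi xi - perp_form xi v v / cost_ratio (enorm v).

Let perp_ratio xi v := perp_form xi v v / cost_ratio (enorm v).

Lemma cost_ratio_enorm_gt0 v : v != 0 -> enorm v < pi -> 0 < cost_ratio (enorm v).
Proof. by move=> v0 vpi; rewrite cost_ratio_gt0// enorm_gt0. Qed.

Lemma perp_ratio_ge0 xi v : enorm v < pi -> 0 <= perp_ratio xi v.
Proof.
move=> vpi; have [->|v0] := eqVneq v 0.
  by rewrite /perp_ratio /perp_form !dotp0l !mul0r subr0 mul0r.
by rewrite divr_ge0 ?perp_form_ge0// ltW// cost_ratio_enorm_gt0.
Qed.

(** The case of [perp_ratio_convex] in which one of the two vectors is 0, where
    q takes a default value instead of its limit 3; monotonicity of q is
    enough. *)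
Lemma perp_ratio_scale xi v t : 0 <= t <= 1 -> enorm v < pi ->
  perp_ratio xi (t *: v) <= t * perp_ratio xi v.
Proof.
move=> /andP[t0 t1] vpi.
have [->|v0] := eqVneq v 0.
  by rewrite scaler0 /perp_ratio /perp_form !dotp0l !mul0r subr0 mul0r mulr0.
have [->|tn0] := eqVneq t 0.
  by rewrite scale0r mul0r /perp_ratio /perp_form !dotp0l !mul0r subr0 mul0r.
have tp : 0 < t by rewrite lt0r tn0.
have e0 := enorm_gt0 v0.
have Q0 := cost_ratio_enorm_gt0 v0 vpi.
have le : cost_ratio (enorm v) <= cost_ratio (enorm (t *: v)).
  by apply: cost_ratio_nincr => //; rewrite enormZ gtr0_norm// ?mulr_gt0// ger_pMl.
have -> : perp_ratio xi (t *: v) =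
    t * (perp_form xi v v / (cost_ratio (enorm (t *: v)) / t)).
  rewrite /perp_ratio /perp_form !dotp_lin; field.
  by rewrite tn0 gt_eqF// (lt_le_trans Q0).
apply: ler_wpM2l => //; apply: ler_wpM2l; first exact: perp_form_ge0.
have Qt := lt_le_trans Q0 le; have Qtt := divr_gt0 Qt tp.
rewrite lef_pV2 ?posrE//.
move: Q0 le; move: (cost_ratio _) (cost_ratio _) => q q' q0 qq'.
by rewrite ler_pdivlMr// (le_trans _ qq')// ler_piMr// ltW.
Qed.

(** A form N divided by a concave q is convex: with q_t the combination of q0
    and q1, the gap between the combination of the N(v_i) / q_i and
    N(v_t) / q_t is t (1 - t) N(q1 v0 - q0 v1) / (q0 q1 q_t). *)
Lemma perp_ratio_convex xi v0 v1 t : 0 <= t <= 1 ->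
  enorm v0 < pi -> enorm v1 < pi ->
  perp_ratio xi ((1 - t) *: v0 + t *: v1) <=
  (1 - t) * perp_ratio xi v0 + t * perp_ratio xi v1.
Proof.
move=> t01 v0pi v1pi; have /andP[t0 t1] := t01.
have t10 : 0 <= 1 - t <= 1 by rewrite subr_ge0 t1 gerBl.
have t1' : 0 <= 1 - t by case/andP: t10.
have [v00|v0n] := eqVneq v0 0.
  rewrite v00 scaler0 add0r.
  apply: (le_trans (perp_ratio_scale _ t01 v1pi)).
  by rewrite lerDr mulr_ge0 ?perp_ratio_ge0 ?enorm0 ?pi_gt0.
have [v10|v1n] := eqVneq v1 0.
  rewrite v10 scaler0 addr0; apply: (le_trans (perp_ratio_scale _ t10 v0pi)).
  by rewrite lerDl mulr_ge0 ?perp_ratio_ge0 ?enorm0 ?pi_gt0.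
set vt := _ + t *: v1.
have [vt0|vtn] := eqVneq vt 0.
  rewrite vt0 {1}/perp_ratio /perp_form !dotp0l !mul0r subr0 mul0r.
  by apply: addr_ge0; apply: mulr_ge0 => //; exact: perp_ratio_ge0.
have Q0 := cost_ratio_enorm_gt0 v0n v0pi; have Q1 := cost_ratio_enorm_gt0 v1n v1pi.
have le : (1 - t) * cost_ratio (enorm v0) + t * cost_ratio (enorm v1) <= cost_ratio (enorm vt).
  have vtle := ler_enormD ((1 - t) *: v0) (t *: v1).
  rewrite !enormZ (ger0_norm t0) (ger0_norm t1') in vtle.
  by apply: cost_ratio_concave; rewrite ?enorm_gt0 ?v0pi ?v1pi.
have nt0 := perp_form_ge0 xi vt.
have := perp_form_ge0 xi (cost_ratio (enorm v1) *: v0 - cost_ratio (enorm v0) *: v1).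
rewrite /perp_ratio; move: le Q0 Q1.
move: (cost_ratio (enorm v0)) (cost_ratio (enorm v1)) (cost_ratio (enorm vt)).
move=> q0 q1 qt le q00 q10 n0.
have q_gt0 : 0 < (1 - t) * q0 + t * q1.
  move: t0; rewrite le_eqVlt => /predU1P[<-|t0]; first by rewrite subr0 mul1r mul0r addr0.
  by rewrite ltr_wpDl ?mulr_gt0// mulr_ge0 ?subr_ge0// ltW.
apply: (@le_trans _ _ (perp_form xi vt vt / ((1 - t) * q0 + t * q1))).
  by apply: ler_wpM2l => //; rewrite lef_pV2 ?posrE// (lt_le_trans q_gt0).
rewrite ler_pdivrMr// -subr_ge0.
have -> : ((1 - t) * (perp_form xi v0 v0 / q0) + t * (perp_form xi v1 v1 / q1))
   * ((1 - t) * q0 + t * q1) - perp_form xi vt vt =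
   t * (1 - t) / (q0 * q1) *
   perp_form xi (q1 *: v0 - q0 *: v1) (q1 *: v0 - q0 *: v1).
  rewrite /perp_form /vt !dotp_lin [dotp v1 v0]dotpC; field.
  by rewrite !gt_eqF.
by rewrite mulr_ge0// mulr_ge0 ?invr_ge0 ?mulr_ge0 ?subr_ge0// ltW.
Qed.

Lemma cost_hess_concave xi v0 v1 t : 0 <= t <= 1 ->
  enorm v0 < pi -> enorm v1 < pi ->
  (1 - t) * cost_hess v0 xi + t * cost_hess v1 xi <=
  cost_hess ((1 - t) *: v0 + t *: v1) xi.
Proof.
move=> t01 v0pi v1pi; have := perp_ratio_convex xi t01 v0pi v1pi.
rewrite /cost_hess /perp_ratio; lra.
Qed.

End CurvatureForm.

(** * Log-concavity of the determinant *)

Section Determinants.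
Variable R : realType.
Implicit Types (t : R).

Lemma weighted_amgm (a b t : R) : 0 < a -> 0 < b -> 0 <= t <= 1 ->
  a `^ (1 - t) * b `^ t <= (1 - t) * a + t * b.
Proof.
move=> a0 b0 /andP[t0 t1].
set c := _ + t * b.
have c0 : 0 < c.
  move: t0; rewrite /c le_eqVlt => /predU1P[<-|t0].
    by rewrite subr0 mul1r mul0r addr0.
  by rewrite ltr_wpDl ?mulr_gt0// mulr_ge0 ?subr_ge0// ltW.
rewrite -ler_ln ?posrE ?mulr_gt0 ?powR_gt0//.
rewrite lnM ?posrE ?powR_gt0// !ln_powR.
have ln_le (x : R) : 0 < x -> ln x <= ln c + (x / c - 1).
  move=> x0; have := @le_ln1Dx R (x / c - 1).
  rewrite (_ : 1 + (x / c - 1) = x / c); last by ring.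
  rewrite lnM ?posrE ?invr_gt0// lnV ?posrE//.
  have xc : 0 < x / c by rewrite divr_gt0.
  move=> h; have : ln x - ln c <= x / c - 1 by apply: h; lra.
  lra.
apply: (@le_trans _ _ ((1 - t) * (ln c + (a / c - 1)) + t * (ln c + (b / c - 1)))).
  by apply: lerD; apply: ler_wpM2l; rewrite ?subr_ge0 ?ln_le.
rewrite le_eqVlt; apply/orP; left; apply/eqP.
have : (1 - t) * (a / c) + t * (b / c) = 1.
  by rewrite !mulrA -mulrDl divff// gt_eqF.
lra.
Qed.

Definition qform m (H : 'M[R]_m) (u : 'rV[R]_m) : R := dotp (u *m H) u.

Definition posdef m (H : 'M[R]_m) :=
  H^T = H /\ forall u, u != 0 -> 0 < qform H u.

Lemma dotp_mulmx_sym m (H : 'M[R]_m) (u v : 'rV[R]_m) :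
  H^T = H -> dotp (u *m H) v = dotp (v *m H) u.
Proof. by move=> sH; rewrite [RHS]dotpC /dotp trmx_mul sH mulmxA. Qed.

Lemma qformD m (H : 'M[R]_m) (u v : 'rV[R]_m) : H^T = H ->
  qform H (u + v) = qform H u + 2 * dotp (u *m H) v + qform H v.
Proof.
move=> sH; rewrite /qform mulmxDl !dotp_lin (dotp_mulmx_sym v u sH); ring.
Qed.

Lemma qformZ m (H : 'M[R]_m) (u : 'rV[R]_m) (a : R) :
  qform H (a *: u) = a ^+ 2 * qform H u.
Proof. by rewrite /qform -scalemxAl !dotp_lin; ring. Qed.

Lemma dotp_row_mx m1 m2 (a b : 'rV[R]_m1) (c d : 'rV[R]_m2) :
  dotp (row_mx a c) (row_mx b d) = dotp a b + dotp c d.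
Proof. by rewrite /dotp tr_row_mx mul_row_col mxE. Qed.

Lemma qform_drsubmx m (H : 'M[R]_(1 + m)) (w : 'rV[R]_m) :
  qform H (row_mx 0 w) = qform (drsubmx H) w.
Proof.
rewrite /qform -{1}[H]submxK mul_row_block !mul0mx !add0r dotp_row_mx dotp0r.
by rewrite add0r.
Qed.

Lemma posdef_drsubmx m (H : 'M[R]_(1 + m)) : posdef H -> posdef (drsubmx H).
Proof.
move=> [sH pH]; split; first by rewrite -[in RHS]sH trmx_drsub.
move=> w w0; rewrite -qform_drsubmx; apply: pH.
by apply: contra_neq w0 => /(congr1 rsubmx); rewrite row_mxKr linear0.
Qed.

(** Completing the square: the Schur complement of the lower right block is the
    minimum of the quadratic form over the vectors with first coordinate 1.
    This makes it concave and monotone in H. *)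
Lemma schur_complement m (H : 'M[R]_(1 + m)) : posdef H ->
  drsubmx H \in unitmx ->
  exists s w, [/\ \det H = s * \det (drsubmx H), s = qform H (row_mx 1 w) &
    forall w', s <= qform H (row_mx 1 w')].
Proof.
move=> pH Du; have [sH _] := pH; have [_ pD] := posdef_drsubmx pH.
set D := drsubmx H in Du pD *.
pose w := - (ursubmx H *m invmx D).
pose S := ulsubmx H + w *m dlsubmx H.
have uH : row_mx 1 w *m H = row_mx S 0.
  rewrite -{1}[H]submxK mul_row_block !mul1mx -/D /S /w !mulNmx.
  by rewrite -(mulmxA _ (invmx D) D) mulVmx// mulmx1 subrr.
exists (S 0 0), w; split.
- have LH : block_mx 1 w 0 1 *m H = block_mx S 0 (dlsubmx H) D.
    rewrite -{1}[H]submxK mulmx_block !mul1mx !mul0mx !add0r -/D /S.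
    congr block_mx; rewrite /w mulNmx -mulmxA mulVmx// mulmx1 subrr//.
  have := congr1 (fun M => \det M) LH.
  by rewrite /= det_mulmx det_ublock !det1 !mul1r det_lblock det_mx11.
- by rewrite /qform uH dotp_row_mx dotp0l addr0 /dotp trmx1 mulmx1.
move=> w'; have -> : row_mx 1 w' = row_mx 1 w + row_mx 0 (w' - w).
  by rewrite add_row_mx addr0 addrC subrK.
rewrite qformD// {1}/qform uH !dotp_row_mx !dotp0l dotp0r !addr0 mulr0 addr0.
rewrite /dotp trmx1 mulmx1 lerDl qform_drsubmx.
have [->|w0] := eqVneq (w' - w) 0; last exact/ltW/pD.
by rewrite /qform mul0mx dotp0l.
Qed.

Lemma row_mx1_neq0 m (w : 'rV[R]_m) : row_mx (1 : 'rV_1) w != 0.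
Proof.
apply/eqP => /(congr1 lsubmx); rewrite row_mxKl linear0 => /matrixP/(_ 0 0).
by rewrite !mxE/= => /eqP; rewrite oner_eq0.
Qed.

Lemma posdef_det_gt0 m (H : 'M[R]_m) : posdef H -> 0 < \det H.
Proof.
elim: m => [|m IH] in H *; first by rewrite det_mx00.
move=> pH; have /IH D0 := posdef_drsubmx (H := (H : 'M[R]_(1 + m))) pH.
have Du : drsubmx (H : 'M[R]_(1 + m)) \in unitmx by rewrite unitmxE unitfE gt_eqF.
have [s [w [-> -> _]]] := schur_complement (H := (H : 'M[R]_(1 + m))) pH Du.
by rewrite mulr_gt0//; case: pH => _; apply; exact: row_mx1_neq0.
Qed.

Lemma posdef_det_log_concave m (H0 H1 Ht : 'M[R]_m) t : 0 <= t <= 1 ->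
  posdef H0 -> posdef H1 -> posdef Ht ->
  (forall u, (1 - t) * qform H0 u + t * qform H1 u <= qform Ht u) ->
  \det H0 `^ (1 - t) * \det H1 `^ t <= \det Ht.
Proof.
move=> t01; have /andP[t0 t1] := t01.
elim: m => [|m IH] in H0 H1 Ht *.
  by rewrite !det_mx00 !powR1 mulr1.
move=> p0 p1 pt le.
have unit (H : 'M[R]_(1 + m)) : posdef H -> drsubmx H \in unitmx.
  move=> /posdef_drsubmx/posdef_det_gt0 D0.
  by rewrite unitmxE unitfE gt_eqF.
have D0 := posdef_det_gt0 (posdef_drsubmx (H := (H0 : 'M[R]_(1 + m))) p0).
have D1 := posdef_det_gt0 (posdef_drsubmx (H := (H1 : 'M[R]_(1 + m))) p1).
have Dt := posdef_det_gt0 (posdef_drsubmx (H := (Ht : 'M[R]_(1 + m))) pt).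
have [s0 [w0 [-> E0 m0]]] := schur_complement (H := (H0 : 'M[R]_(1 + m))) p0 (unit _ p0).
have [s1 [w1 [-> E1 m1]]] := schur_complement (H := (H1 : 'M[R]_(1 + m))) p1 (unit _ p1).
have [st [wt [-> Et mt]]] := schur_complement (H := (Ht : 'M[R]_(1 + m))) pt (unit _ pt).
have s0_gt0 : 0 < s0 by rewrite E0; case: p0 => _; apply; exact: row_mx1_neq0.
have s1_gt0 : 0 < s1 by rewrite E1; case: p1 => _; apply; exact: row_mx1_neq0.
have s_le : s0 `^ (1 - t) * s1 `^ t <= st.
  apply: (le_trans (weighted_amgm s0_gt0 s1_gt0 t01)); rewrite Et.
  by apply: le_trans (le _); apply: lerD; apply: ler_wpM2l; rewrite ?subr_ge0.
have D_le : \det (drsubmx (H0 : 'M[R]_(1 + m))) `^ (1 - t) *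
    \det (drsubmx (H1 : 'M[R]_(1 + m))) `^ t <= \det (drsubmx (Ht : 'M[R]_(1 + m))).
  apply: IH; try exact: (@posdef_drsubmx m).
  by move=> u; rewrite -!qform_drsubmx.
rewrite (powRM _ (ltW s0_gt0) (ltW D0)) (powRM _ (ltW s1_gt0) (ltW D1)) mulrACA.
by apply: ler_pM => //; rewrite mulr_ge0 ?powR_ge0.
Qed.

Definition possemidef m (H : 'M[R]_m) := H^T = H /\ forall u, 0 <= qform H u.

(** A vector on which a semidefinite form vanishes lies in its kernel. *)
Lemma possemidef_det m (H : 'M[R]_m) : possemidef H ->
  \det H = 0 \/ posdef H.
Proof.
move=> [sH pH]; have [|d0] := eqVneq (\det H) 0; [by left|right; split=> // u u0].
rewrite lt0r pH andbT; apply: contra_neq u0 => q0.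
have uH : u *m H = 0.
  apply: dotp_eq0; apply/eqP; rewrite -sqrf_eq0; apply/eqP.
  set v := u *m H; set q := qform H v.
  have le (s : R) : 0 <= 2 * s * dotp v v + s ^+ 2 * q.
    have := pH (u + s *: v).
    by rewrite qformD// q0 add0r qformZ dotpZr mulrA.
  have qp := pH v; rewrite -/q in qp.
  have vp := dotp_ge0 v.
  (* The exact minimum of the quadratic le in s is at - |v|^2 / q; the
     denominator q + 1 avoids the case q = 0. *)
  have := le (- (dotp v v / (q + 1))).
  have q1 : 0 < q + 1 by rewrite ltr_wpDl.
  have -> : 2 * - (dotp v v / (q + 1)) * dotp v v +
     (- (dotp v v / (q + 1))) ^+ 2 * q =
     - (dotp v v ^+ 2 * (q + 2) / (q + 1) ^+ 2).
    by field; rewrite gt_eqF.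
  have q2 : 0 < (q + 2) / (q + 1) ^+ 2 by rewrite divr_gt0 ?exprn_gt0// ltr_wpDl.
  rewrite oppr_ge0 -mulrA pmulr_lle0// => h.
  by apply/eqP; rewrite eq_le h sqr_ge0.
have Hu : H \in unitmx by rewrite unitmxE unitfE.
by rewrite -[u]mulmx1 -(mulmxV Hu) mulmxA uH mul0mx.
Qed.

Lemma possemidef_det_ge0 m (H : 'M[R]_m) : possemidef H -> 0 <= \det H.
Proof. by move=> /possemidef_det[->//|/posdef_det_gt0/ltW]. Qed.

Lemma det_log_concave m (H0 H1 Ht : 'M[R]_m) t : 0 < t < 1 ->
  possemidef H0 -> possemidef H1 -> possemidef Ht ->
  (forall u, (1 - t) * qform H0 u + t * qform H1 u <= qform Ht u) ->
  \det H0 `^ (1 - t) * \det H1 `^ t <= \det Ht.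
Proof.
move=> /andP[t0 t1] p0 p1 pt le.
have dt := possemidef_det_ge0 pt.
have [->|q0] := possemidef_det p0; first by rewrite powR0 ?mul0r// subr_eq0 gt_eqF.
have [->|q1] := possemidef_det p1; first by rewrite powR0 ?mulr0// gt_eqF.
apply: posdef_det_log_concave => //; first by rewrite !ltW.
split; first by case: pt.
move=> u u0; apply: lt_le_trans (le u).
by case: q0 => _ /(_ u u0) ?; case: q1 => _ /(_ u u0) ?; rewrite addr_gt0 ?mulr_gt0 ?subr_gt0.
Qed.

End Determinants.

(** * Oriented frames and the differential of the exponential map *)

Section Frames.
Variable R : realType.

(** Both sides are the determinant of the block matrix B below. *)
Lemma det_add1_mulC m k (U : 'M[R]_(m, k)) (V : 'M[R]_(k, m)) :
  \det (1%:M + U *m V) = \det (1%:M + V *m U).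
Proof.
pose B := block_mx 1%:M (- U) V 1%:M.
have -> : \det (1%:M + U *m V) = \det B.
  have : block_mx 1%:M U 0 1%:M *m B = block_mx (1%:M + U *m V) 0 V 1%:M.
    by rewrite mulmx_block !mul1mx !mulmx1 !mul0mx !add0r addNr.
  move=> /(congr1 determinant).
  by rewrite det_mulmx det_ublock det_lblock !det1 !mul1r mulr1.
have : block_mx 1%:M 0 (- V) 1%:M *m B = block_mx 1%:M (- U) 0 (1%:M + V *m U).
  rewrite mulmx_block !mul1mx !mulmx1 !mul0mx !addr0 addNr.
  by rewrite mulNmx mulmxN opprK [V *m U + _]addrC.
move=> /(congr1 determinant).
by rewrite det_mulmx det_lblock det_ublock !det1 !mul1r.
Qed.

Lemma det_block11 (a b c d : 'M[R]_1) :
  \det (block_mx a b c d) = a 0 0 * d 0 0 - b 0 0 * c 0 0.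
Proof.
rewrite (expand_det_row _ (lshift 1 0)) big_split_ord !big_ord1 /=.
rewrite block_mxEul block_mxEur /cofactor !det_mx11 !mxE.
have -> : lift (lshift 1 (0 : 'I_1)) 0 = rshift 1 0 by exact/val_inj.
have -> : lift (rshift 1 (0 : 'I_1)) 0 = lshift 1 0 by exact/val_inj.
have -> : fintype.split (rshift 1 (0 : 'I_1)) = inr (0 : 'I_1) := unsplitK (inr 0).
by rewrite row_mxEl row_mxEr /= expr0 expr1 mul1r mulN1r mulrN.
Qed.

(** On T_x this is the differential of exp_x at v, with values in T_y for
    y = exp_x v; moreover it sends x to y.  In the plane of x and v it is the
    rotation that takes x to y, and on the orthogonal complement it multiplies
    by sin |v| / |v|. *)
Definition transport n (x v : 'rV[R]_n.+1) : 'M[R]_n.+1 :=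
  let c := cos (enorm v) in let s := sinc (enorm v) in
  s%:M + x^T *m ((c - s) *: x + s *: v)
       + v^T *m (- s *: x + ((c - s) / dotp v v) *: v).

Lemma mul_dotp m (u v : 'rV[R]_m) : u *m v^T = (dotp u v)%:M.
Proof. by rewrite [LHS]mx11_scalar. Qed.

Lemma mulmx_transport n (x v u : 'rV[R]_n.+1) :
  u *m transport x v = sinc (enorm v) *: u +
   dotp u x *: ((cos (enorm v) - sinc (enorm v)) *: x + sinc (enorm v) *: v) +
   dotp u v *: (- sinc (enorm v) *: x +
     ((cos (enorm v) - sinc (enorm v)) / dotp v v) *: v).
Proof.
rewrite /transport 2!mulmxDr !mulmxA !mul_dotp !mul_scalar_mx mul_mx_scalar.
by [].
Qed.

Lemma sinc_sqrD n (v : 'rV[R]_n) :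
  cos (enorm v) ^+ 2 + sinc (enorm v) ^+ 2 * dotp v v = 1.
Proof.
rewrite -enorm_sqr -exprMn -(cos2Dsin2 (enorm v)); congr (_ + _ ^+ 2).
have [->|e0] := eqVneq (enorm v) 0; first by rewrite mulr0 sin0.
by rewrite sincE// divfK.
Qed.

(** The matrix is sin |v| / |v| times a perturbation of the identity of rank 2,
    which reduces the determinant to a 2 x 2 one. *)
Lemma det_transport n (x v : 'rV[R]_n.+2) : enorm x = 1 -> dotp x v = 0 ->
  enorm v < pi -> \det (transport x v) = sinc (enorm v) ^+ n.
Proof.
move=> x1 xv vpi.
have s0 : 0 < sinc (enorm v) by rewrite sinc_gt0// enorm_ge0.
have xx : dotp x x = 1 by rewrite -enorm_sqr x1 expr1n.
have cs := sinc_sqrD v.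
have cs0 : v = 0 -> cos (enorm v) = sinc (enorm v).
  by move=> ->; rewrite enorm0 cos0 sinc0.
have vvn : v != 0 -> dotp v v != 0 by move/dotp_gt0/lt0r_neq0.
rewrite /transport; move: s0 cs cs0; set s := sinc _; set c := cos _ => s0 cs cs0.
have sn0 := lt0r_neq0 s0.
pose a := (c - s) *: x + s *: v; pose b := - s *: x + ((c - s) / dotp v v) *: v.
have -> : s%:M + x^T *m a + v^T *m b =
    s *: (1%:M + row_mx x^T v^T *m (s^-1 *: col_mx a b)).
  rewrite scalerDr -scalemxAr scalerA divff// scale1r mul_row_col addrA.
  by rewrite scale_scalar_mx mulr1.
rewrite detZ det_add1_mulC -scalemxAl mul_col_row !mul_dotp scale_block_mx.
rewrite -[1%:M]/(1%:M : 'M[R]_(1 + 1)) (scalar_mx_block 1 1) add_block_mx det_block11.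
rewrite !mxE !eqxx !mulr1n ?mulr0n !add0r.
rewrite /a /b !dotp_lin [dotp v x]dotpC xv xx !(mulr0, addr0, add0r, mulr1).
have -> : (c - s) / dotp v v * dotp v v = c - s.
  have [v0|/vvn vv] := eqVneq v 0; last by rewrite divfK.
  by rewrite cs0// subrr !mul0r.
rewrite 2!exprSr -!mulrA -[RHS]mulr1; congr (_ * _); rewrite -[RHS]cs.
by field.
Qed.

Lemma usphere_dotp n (x : 'rV[R]_n.+1) : usphere x -> dotp x x = 1.
Proof. by rewrite /usphere/= => x1; rewrite -enorm_sqr x1 expr1n. Qed.

Lemma dotp_usphere n (x : 'rV[R]_n.+1) : dotp x x = 1 -> usphere x.
Proof. by rewrite /usphere/= /enorm => ->; rewrite sqrtr1. Qed.

(** The Householder reflection that exchanges x with the first basis vector is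
    orthogonal and has x as its first row. *)
Lemma orthogonal_extension n (x : 'rV[R]_n.+1) : usphere x ->
  exists E : 'M[R]_(n, n.+1),
    (col_mx x E : 'M[R]_(1 + n)) *m (col_mx x E)^T = 1%:M.
Proof.
move=> /usphere_dotp xx.
pose e : 'rV[R]_n.+1 := delta_mx 0 0; pose u := e - x.
have ee : dotp e e = 1.
  by rewrite /dotp /e trmx_delta mul_delta_mx mxE !eqxx.
have [P PP eP] : exists2 P : 'M[R]_n.+1, P *m P^T = 1%:M & e *m P = x.
  have u_def : u = e - x by [].
  clearbody u; have [u0|u0] := eqVneq u 0.
    exists 1%:M; first by rewrite trmx1 mulmx1.
    by rewrite mulmx1; apply/eqP; rewrite -subr_eq0 -u_def u0.
  have uu := dotp_gt0 u0.
  have uE : dotp u u = 2 * dotp e u.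
    by rewrite u_def !dotp_lin ee xx [dotp x e]dotpC; ring.
  exists (1%:M - (2 / dotp u u) *: (u^T *m u)).
    have -> : (1%:M - (2 / dotp u u) *: (u^T *m u))^T =
        1%:M - (2 / dotp u u) *: (u^T *m u).
      by rewrite linearB/= linearZ/= trmx1 trmx_mul trmxK.
    have WW : (u^T *m u) *m (u^T *m u) = dotp u u *: (u^T *m u).
      by rewrite mulmxA -(mulmxA _ u) mul_dotp mul_mx_scalar -scalemxAl.
    move: (u^T *m u) WW => W WW.
    rewrite mulmxBl mul1mx mulmxBr mulmx1 -scalemxAl -scalemxAr WW !scalerA.
    rewrite -[RHS]subr0 -addrA; congr (_ + _).
    rewrite opprB -!scaleNr -!scalerDl oppr0 [X in X *: _](_ : _ = 0) ?scale0r//.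
    by rewrite /GRing.scale/=; field; rewrite gt_eqF.
  rewrite mulmxBr mulmx1 -scalemxAr mulmxA mul_dotp mul_scalar_mx scalerA.
  have -> : 2 / dotp u u * dotp e u = 1.
    by rewrite uE; field; rewrite gt_eqF// -(pmulr_rgt0 _ (ltr0n R 2)) -uE.
  by rewrite scale1r u_def subKr.
have xP : usubmx (P : 'M[R]_(1 + n, _)) = x.
  rewrite -eP; apply/rowP => j; rewrite !mxE (bigD1 0)//= big1 => [|i i0].
    by rewrite !mxE !eqxx mul1r addr0; congr (P _ _); exact/val_inj.
  by rewrite !mxE (negbTE i0) andbF mul0r.
exists (dsubmx (P : 'M[R]_(1 + n, _))).
by rewrite -xP vsubmxK; exact: PP.
Qed.

Lemma oriented_frameP n (x : 'rV[R]_n.+1) (E : 'M[R]_(n, n.+1)) :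
  usphere x -> oriented_frame x E ->
  (col_mx x E : 'M[R]_(1 + n)) *m (col_mx x E)^T = 1%:M /\
  \det (col_mx x E : 'M[R]_(1 + n)) = 1.
Proof.
move=> /usphere_dotp xx [EE Ex d0].
have PP : (col_mx x E : 'M[R]_(1 + n)) *m (col_mx x E)^T = 1%:M.
  rewrite tr_col_mx mul_col_row EE Ex mul_dotp xx.
  rewrite (_ : x *m E^T = 0) ?(scalar_mx_block 1 n)//.
  by rewrite -[LHS]trmxK trmx_mul trmxK Ex trmx0.
split=> //; have /eqP := congr1 determinant PP.
rewrite det_mulmx det_tr det1 -expr2 sqrf_eq1 => /orP[/eqP//|/eqP h].
by move: d0; rewrite h ltr0N1.
Qed.

(** If the orthogonal extension of x has determinant -1, reversing the first
    vector of the frame corrects it; this needs a tangent space of positive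
    dimension. *)
Lemma frame_oriented n (x : 'rV[R]_n.+2) : usphere x -> oriented_frame x (frame x).
Proof.
move=> xS; suff [E EP] : exists E, oriented_frame x E by exact: (xgetPex 0 (ex_intro _ E EP)).
have [E PP] := orthogonal_extension xS.
have : block_mx (x *m x^T) (x *m E^T) (E *m x^T) (E *m E^T) =
       block_mx 1%:M 0 0 1%:M.
  by rewrite -mul_col_row -tr_col_mx PP (scalar_mx_block 1).
move=> /eq_block_mx[_ _ Ex EE].
have : \det (col_mx x E : 'M[R]_(1 + n.+1)) != 0.
  apply/eqP => d0; have /eqP := congr1 determinant PP.
  by rewrite det_mulmx d0 mul0r det1 eq_sym oner_eq0.
rewrite neq_lt => /orP[dneg|dpos]; last by exists E.
pose d : 'rV[R]_n.+1 := \row_i (if i == 0 then -1 else 1).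
have dd : diag_mx d *m diag_mx d = 1%:M.
  rewrite mulmx_diag; apply/matrixP => i j; rewrite !mxE.
  by case: ifP => _; rewrite ?mulrNN mulr1.
exists (diag_mx d *m E); split.
- by rewrite trmx_mul mulmxA -(mulmxA _ E) EE mulmx1 tr_diag_mx dd.
- by rewrite -mulmxA Ex mulmx0.
have -> : col_mx x (diag_mx d *m E) = block_mx 1%:M 0 0 (diag_mx d) *m col_mx x E.
  by rewrite mul_block_col mul1mx !mul0mx addr0 add0r.
rewrite det_mulmx det_ublock det1 mul1r det_diag big_ord_recl.
rewrite big1 => [|i _]; last by rewrite !mxE.
by rewrite !mxE/= mulr1 mulN1r oppr_gt0.
Qed.

Lemma frame_proj n (x : 'rV[R]_n.+1) (E : 'M[R]_(n, n.+1)) (w : 'rV[R]_n.+1) :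
  usphere x -> oriented_frame x E -> dotp w x = 0 -> w *m E^T *m E = w.
Proof.
move=> xS oE wx; have [PP _] := oriented_frameP xS oE.
have : (col_mx x E)^T *m (col_mx x E : 'M[R]_(1 + n)) = 1%:M by apply: mulmx1C.
rewrite tr_col_mx mul_row_col => /(congr1 (fun M => w *m M)).
by rewrite mulmx1 mulmxDr !mulmxA mul_dotp wx mul_scalar_mx scale0r add0r.
Qed.

(** Completing the frames by x and y gives rotations, in which the matrix of A
    is block triangular with upper left entry 1. *)
Lemma det_frames n (x y : 'rV[R]_n.+1) (E F : 'M[R]_(n, n.+1)) (A : 'M[R]_n.+1) :
  usphere x -> usphere y -> oriented_frame x E -> oriented_frame y F ->
  x *m A = y -> \det (E *m A *m F^T) = \det A.
Proof.
move=> xS yS oE oF xA.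
have [_ dE] := oriented_frameP xS oE; have [_ dF] := oriented_frameP yS oF.
have [_ Fy _] := oF.
have yF : y *m F^T = 0 by rewrite -[LHS]trmxK trmx_mul trmxK Fy trmx0.
have : \det ((col_mx x E : 'M[R]_(1 + n)) *m A *m (col_mx y F : 'M[R]_(1 + n))^T) = \det A.
  by rewrite !det_mulmx det_tr dE dF mul1r mulr1.
rewrite mul_col_mx xA tr_col_mx mul_col_row yF det_lblock mul_dotp.
by rewrite (usphere_dotp yS) det1 mul1r.
Qed.

End Frames.

(** * Differential calculus in normed modules *)

Section Differentials.
Variables (R : realType) (V W : normedModType R).
Implicit Types (x h : V).

Lemma differentiable_remainder (f : V -> W) x : differentiable f x ->
  forall e : R, 0 < e ->
  \forall h \near (0 : V), `|f (h + x) - f x - 'd f x h| <= e * `|h|.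
Proof.
move=> df e e0; have := diff_locallyx df.
set k := the_littleo _ _ _ _ _ => fE.
have := littleoP k e0; apply: filterS => h /=.
have aux (a b c : W) : a + b + c - a - b = c.
  by rewrite -[_ - _ - _]addrA -opprD [a + b + c]addrC addrK.
by rewrite fE aux.
Qed.

Lemma is_diff_remainder (f df : V -> W) x : linear df -> continuous df ->
  (forall e : R, 0 < e ->
    \forall h \near (0 : V), `|f (h + x) - f x - df h| <= e * `|h|) ->
  is_diff x f df.
Proof.
move=> lin cont rem.
pose glM := GRing.isLinear.Build _ _ _ _ df lin.
pose gL : {linear V -> W} := HB.pack df glM.
have E : f \o shift x = cst (f x) + gL +o_ 0 id.
  apply/eqaddoP => e e0; have := rem e e0; apply: filterS => h /=.
  by rewrite !fctE/= opprD addrA.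
have dE : 'd f x = gL :> (V -> W) by apply: diff_unique.
by split; [apply/diff_locallyP; rewrite dE|exact: dE].
Qed.

Lemma is_diff_linear (f : V -> W) x : linear f -> continuous f -> is_diff x f f.
Proof.
move=> lin cont; apply: is_diff_remainder => // e e0.
near=> h; rewrite -[h]scale1r lin !scale1r addrK subrr normr0 mulr_ge0// ltW//.
Unshelve. all: by end_near. Qed.

(** A product needs only continuity of the first factor at a zero of the
    second.  This covers the terms of the exponential map at v = 0, where the
    Euclidean norm is not differentiable. *)
Lemma is_diff_scale_vanish (a : V -> R) (b db : V -> W) x :
  {for x, continuous a} -> is_diff x b db -> b x = 0 ->
  is_diff x (fun z => a z *: b z) (fun h => a x *: db h).
Proof.
move=> ca [dfb dbE] bx0; rewrite -dbE.
apply: is_diff_remainder.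
- by move=> k u v; rewrite linearP scalerDr !scalerA mulrC.
- move=> z; apply: continuousZl_tmp; exact: diff_continuous.
move=> e e0.
have [k k0 dk] := linear_lipschitz (diff_continuous dfb).
have e1 : 0 < e / 2 / (`|a x| + 1) by rewrite !divr_gt0// ltr_wpDl.
have e2 : 0 < Num.min 1 (e / 2 / k) by rewrite lt_min ltr01 !divr_gt0.
have rem := differentiable_remainder dfb e1.
have ca' : \forall h \near (0 : V), `|a x - a (h + x)| < Num.min 1 (e / 2 / k).
  have sh : (fun h : V => h + x) @ (0 : V) --> x.
    by rewrite -{2}[x]add0r; apply: cvgD; [exact: cvg_id|exact: cvg_cst].
  by have /cvgrPdist_lt/(_ _ e2) := cvg_comp _ _ sh ca.
near=> h; rewrite bx0 scaler0 subr0.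
have hrem : `|b (h + x) - b x - 'd b x h| <= e / 2 / (`|a x| + 1) * `|h| by near: h.
rewrite bx0 subr0 in hrem.
have : `|a x - a (h + x)| < Num.min 1 (e / 2 / k) by near: h.
rewrite lt_min => /andP[a1 a2].
have -> : a (h + x) *: b (h + x) - a x *: 'd b x h =
    a (h + x) *: (b (h + x) - 'd b x h) - (a x - a (h + x)) *: 'd b x h.
  by rewrite scalerBr scalerBl opprB addrA subrK.
apply: (le_trans (ler_normB _ _)); rewrite !normrZ.
have -> : e * `|h| = (`|a x| + 1) * (e / 2 / (`|a x| + 1) * `|h|) + e / 2 / k * (k * `|h|).
  by field; rewrite !gt_eqF// ltr_wpDl.
apply: lerD; apply: ler_pM => //; last exact: ltW.
have : `|a (h + x)| <= `|a x| + `|a x - a (h + x)|.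
  by rewrite -{1}[a (h + x)](subKr (a x)) (le_trans (ler_normB _ _)).
lra.
Unshelve. all: by end_near. Qed.

Lemma is_diff_scale (a da : V -> R) (b db : V -> W) x :
  is_diff x a da -> is_diff x b db ->
  is_diff x (fun z => a z *: b z) (fun h => da h *: b x + a x *: db h).
Proof.
move=> ha hb.
have h1 : is_diff x (fun z => a z *: (b z - b x)) (fun h => a x *: db h).
  apply: is_diff_scale_vanish; last by rewrite subrr.
  - by apply: differentiable_continuous; case: ha.
  - refine (is_diff_eq (is_diffB hb (is_diff_cst (b x) x)) _).
    by apply/funext => h; rewrite fctE/= subr0.
have h2 : is_diff x (fun z => a z *: b x) (fun h => da h *: b x).
  have [da1 daE] := ha; split; first exact: differentiableZl.
  by rewrite diffZl// daE.
have := is_diffD h2 h1; congr (is_diff_def _ _ _).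
by apply/funext => z; rewrite fctE/= -scalerDr addrC subrK.
Qed.

End Differentials.

Lemma is_diff_unique (R : realType) (V W : normedModType R) (f d1 d2 : V -> W) x :
  is_diff x f d1 -> is_diff x f d2 -> d1 = d2.
Proof. by move=> [_ <-] [_ <-]. Qed.

Lemma is_diff_near_eq (R : realType) (V W : normedModType R) (f g df : V -> W) x :
  (\forall z \near x, f z = g z) -> is_diff x f df -> is_diff x g df.
Proof.
move=> fg [fd <-]; apply: is_diff_remainder.
- by move=> k u w; rewrite linearP.
- exact: diff_continuous.
move=> e e0; have rem := differentiable_remainder fd e0.
have sh : (fun h : V => h + x) @ (0 : V) --> x.
  by rewrite -{2}[x]add0r; apply: cvgD; [exact: cvg_id|exact: cvg_cst].
have fg' : \forall h \near (0 : V), f (h + x) = g (h + x) := sh _ fg.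
near=> h; rewrite -(nbhs_singleton fg) -(near fg' h)//.
by near: h.
Unshelve. all: by end_near. Qed.

Section DifferentialsOfNorms.
Variables (R : realType) (V : normedModType R).
Implicit Types (x h : V).

Lemma is_diff_ext (W : normedModType R) (f df df' : V -> W) x :
  is_diff x f df -> (forall h, df h = df' h) -> is_diff x f df'.
Proof. by move=> hf e; have -> : df' = df by apply/funext => h; rewrite e. Qed.

Lemma is_diff_add (W : normedModType R) (f g df dg : V -> W) x :
  is_diff x f df -> is_diff x g dg ->
  is_diff x (fun z => f z + g z) (fun h => df h + dg h).
Proof. exact: is_diffD. Qed.

Lemma is_diff_sum (W : normedModType R) m (f df : 'I_m -> V -> W) x :
  (forall i, is_diff x (f i) (df i)) ->
  is_diff x (fun z => \sum_i f i z) (fun h => \sum_i df i h).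
Proof.
elim: m f df => [|m IH] f df hf.
  have -> : (fun z => \sum_(i < 0) f i z) = cst 0.
    by apply/funext => z; rewrite big_ord0.
  apply: is_diff_ext (is_diff_cst _ _) _ => h.
  by rewrite big_ord0.
have -> : (fun z => \sum_(i < m.+1) f i z) =
    fun z => f ord0 z + \sum_(i < m) f (lift ord0 i) z.
  by apply/funext => z; rewrite big_ord_recl.
apply: is_diff_ext (is_diff_add (hf ord0) (IH _ (fun i => df (lift ord0 i)) _)) _.
  by move=> i; exact: hf.
by move=> h; rewrite big_ord_recl.
Qed.

Lemma is_diff_coord m (f df : V -> 'rV[R]_m) x i :
  is_diff x f df -> is_diff x (fun z => f z 0 i) (fun h => df h 0 i).
Proof.
move=> hf; have hc : is_diff (f x) (fun N : 'rV[R]_m => N 0 i) (fun N => N 0 i).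
  apply: is_diff_linear; last exact: coord_continuous.
  by move=> k u v; rewrite !mxE.
exact: is_diff_comp hf hc.
Qed.

Lemma is_diff_dotp m (f g df dg : V -> 'rV[R]_m) x :
  is_diff x f df -> is_diff x g dg ->
  is_diff x (fun z => dotp (f z) (g z))
    (fun h => dotp (df h) (g x) + dotp (f x) (dg h)).
Proof.
move=> hf hg.
have -> : (fun z => dotp (f z) (g z)) = fun z => \sum_i (f z 0 i *: g z 0 i).
  by apply/funext => z; rewrite dotpE.
have h i := is_diff_scale (is_diff_coord i hf) (is_diff_coord i hg).
apply: is_diff_ext (is_diff_sum h) _ => k.
by rewrite !dotpE -big_split.
Qed.

Lemma is_diff_of_derive (f : R -> R) (a d : R) :
  is_derive a 1 f d -> is_diff a f (fun h : R => h * d).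
Proof.
move=> [da dE]; split; first exact/derivable1_diffP.
by rewrite (deriv1E da) derive1E dE.
Qed.

Lemma is_diff_scalar_comp (f : R -> R) (d : R) (g dg : V -> R) x :
  is_derive (g x) 1 f d -> is_diff x g dg ->
  is_diff x (fun z => f (g z)) (fun h => dg h * d).
Proof. by move=> /is_diff_of_derive hf hg; exact: is_diff_comp hg hf. Qed.

Lemma is_diff_enorm m (f df : V -> 'rV[R]_m) x : f x != 0 ->
  is_diff x f df ->
  is_diff x (fun z => enorm (f z)) (fun h => dotp (f x) (df h) / enorm (f x)).
Proof.
move=> fx0 hf; have d0 := dotp_gt0 fx0.
apply: is_diff_ext (is_diff_scalar_comp (is_derive1_sqrt d0) (is_diff_dotp hf hf)) _.
have e0 := enorm_gt0 fx0; move=> h; rewrite [dotp (df h) _]dotpC -/(enorm (f x)).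
by field; rewrite gt_eqF.
Qed.

End DifferentialsOfNorms.

Lemma is_diff_lincomb (R : realType) (V W : normedModType R) m (c : 'I_m -> R)
    (f df : 'I_m -> V -> W) x : (forall i, is_diff x (f i) (df i)) ->
  is_diff x (fun z => \sum_i c i *: f i z) (fun h => \sum_i c i *: df i h).
Proof.
by move=> h; apply: (is_diff_sum (f := fun i z => c i *: f i z)) => i; exact: is_diffZ.
Qed.

(** * The radial retraction and the exponential map *)

Section Retraction.
Variables (R : realType) (n : nat).
Local Notation V := ('rV[R]_n.+1).
Implicit Types (x z v h : V).

Lemma usphere_neq0 x : usphere x -> x != 0.
Proof.
move=> /usphere_dotp xx; apply/eqP => x0.
by move: xx; rewrite x0 dotp0l => /eqP; rewrite eq_sym oner_eq0.
Qed.

Lemma retr_usphere z : z != 0 -> usphere (retr z).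
Proof.
move=> /enorm_gt0 z0; rewrite /usphere/= /retr enormZ.
by rewrite ger0_norm ?invr_ge0 ?ltW// mulVf// gt_eqF.
Qed.

Lemma retr_id x : usphere x -> retr x = x.
Proof. by move=> xS; rewrite /retr xS invr1 scale1r. Qed.

Lemma retrZ (a : R) z : 0 < a -> retr (a *: z) = retr z.
Proof.
move=> a0; rewrite /retr enormZ gtr0_norm// invfM scalerA mulrAC mulVf ?mul1r//.
exact: lt0r_neq0.
Qed.

Lemma retr_retr z : retr (retr z) = retr z.
Proof.
have [->|z0] := eqVneq z 0; first by rewrite /retr !scaler0.
by apply: retr_id; exact: retr_usphere.
Qed.

Lemma is_diff_retr z : z != 0 ->
  is_diff z (@retr R n) (fun h => (- (enorm z) ^- 2 * (dotp z h / enorm z)) *: z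
    + (enorm z)^-1 *: h).
Proof.
move=> z0; have e0 := enorm_gt0 z0.
have h1 := is_diff_enorm z0 (is_diff_id z).
have h2 : is_derive (enorm z) 1 (fun r : R => r^-1) (- (enorm z) ^- 2 * 1).
  by apply: (is_derive_invS _ (is_derive_idS _)); exact: lt0r_neq0.
apply: is_diff_ext (is_diff_scale (is_diff_scalar_comp h2 h1) (is_diff_id z)) _.
by move=> h; rewrite mulr1 [_ * - _]mulrC.
Qed.

Lemma is_diff_retr_unit x : usphere x ->
  is_diff x (@retr R n) (fun h => h - dotp x h *: x).
Proof.
move=> xS; apply: is_diff_ext (is_diff_retr (usphere_neq0 xS)) _ => h.
rewrite xS expr1n invr1 !mulr1 mulN1r scaleNr scale1r addrC //.
Qed.

Lemma expsE x v : exps x v = cos (enorm v) *: x + sinc (enorm v) *: v.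
Proof.
rewrite /exps; have [->|v0] := eqVneq v 0; first by rewrite !scaler0.
by rewrite sincE// gt_eqF// enorm_gt0.
Qed.

Lemma exps_usphere x v : usphere x -> dotp x v = 0 -> usphere (exps x v).
Proof.
move=> /usphere_dotp xx xv; apply: dotp_usphere.
rewrite expsE !dotp_lin [dotp v x]dotpC xv xx -[RHS](sinc_sqrD v); ring.
Qed.

Lemma cos_half_sinc (r : R) : cos r = 1 - 2^-1 * sinc (r / 2) ^+ 2 * r ^+ 2.
Proof.
have [->|r0] := eqVneq r 0; first by rewrite cos0 expr0n mulr0 subr0.
have r20 : r / 2 != 0 by rewrite mulf_neq0.
have -> : cos r = cos ((r / 2) *+ 2) by congr cos; rewrite mulr2n -splitr.
rewrite cos_mulr2n cos2sin2 sincE// mulr2n; field.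
by rewrite r0.
Qed.

(** The differential of (x, v) |-> exp_x v in the direction (dx, dv).  At v = 0
    the last coefficient has a denominator 0, but it multiplies v. *)
Definition exps_diff (x v dx dv : V) : V :=
  let c := cos (enorm v) in let s := sinc (enorm v) in
  c *: dx - (s * dotp v dv) *: x + s *: dv
  + ((c - s) / dotp v v * dotp v dv) *: v.

(** At a zero of g the factors cos |g| and sin |g| / |g| are not compositions of
    differentiable maps.  There cos |g| - 1 is a continuous function times
    |g|^2, by the half-angle formula, and sin |g| / |g| is a continuous function
    that multiplies g, so that [is_diff_scale_vanish] applies to both. *)
Lemma is_diff_exps (p g dp dg : V -> V) x :
  is_diff x p dp -> is_diff x g dg ->
  is_diff x (fun z => exps (p z) (g z))
    (fun h => exps_diff (p x) (g x) (dp h) (dg h)).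
Proof.
move=> hp hg.
have -> : (fun z => exps (p z) (g z)) =
    fun z => cos (enorm (g z)) *: p z + sinc (enorm (g z)) *: g z.
  by apply/funext => z; rewrite expsE.
have [g0|g0] := eqVneq (g x) 0.
  have cg : {for x, continuous g}.
    by apply: differentiable_continuous; case: hg.
  have ce : {for x, continuous (fun z => enorm (g z))}.
    apply: (continuous_comp (f := fun z => dotp (g z) (g z)) (g := Num.sqrt)).
      by apply: differentiable_continuous; case: (is_diff_dotp hg hg).
    exact: sqrt_continuous.
  have h1 : is_diff x (fun z => sinc (enorm (g z)) *: g z) dg.
    apply: is_diff_ext (is_diff_scale_vanish _ hg g0) _.
      by apply: continuous_comp; [exact: ce|exact: sinc_continuous].
    by move=> h; rewrite g0 enorm0 sinc0 scale1r.
  have h2 : is_diff x (fun z => cos (enorm (g z))) (fun=> 0).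
    have hq := is_diff_dotp hg hg.
    have h3 : is_diff x (fun z => (- 2^-1 * sinc (enorm (g z) / 2) ^+ 2) *:
        dotp (g z) (g z)) (fun=> 0).
      apply: is_diff_ext (is_diff_scale_vanish _ hq _) _.
      - apply: continuousM; first exact: cst_continuous.
        have cs : {for x, continuous (fun z => sinc (enorm (g z) / 2))}.
          apply: continuous_comp; last exact: sinc_continuous.
          by apply: continuousM; [exact: ce|exact: cst_continuous].
        exact: (continuousM cs cs).
      - by rewrite g0 dotp0l.
      - by move=> h; rewrite g0 dotp0l dotp0r addr0 scaler0.
    have -> : (fun z => cos (enorm (g z))) = fun z => 1 +
        (- 2^-1 * sinc (enorm (g z) / 2) ^+ 2) *: dotp (g z) (g z).
      apply/funext => z; rewrite cos_half_sinc enorm_sqr /GRing.scale/=; ring.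
    apply: is_diff_ext (is_diff_add (is_diff_cst _ x) h3) _.
    by move=> h; rewrite add0r.
  apply: is_diff_ext (is_diff_add (is_diff_scale h2 hp) h1) _ => h.
  rewrite /exps_diff g0 enorm0 cos0 sinc0 !dotp0l !mulr0 !scale0r !scale1r.
  by rewrite add0r subr0 addr0.
have e0 := enorm_gt0 g0; have he := is_diff_enorm g0 hg.
have hc := is_diff_scalar_comp (is_derive_cos _) he.
have hs : is_derive (enorm (g x)) 1 (@sinc R)
    ((cos (enorm (g x)) - sinc (enorm (g x))) / enorm (g x)).
  have h : is_derive (enorm (g x)) 1 (fun r : R => sin r / r)
      ((cos (enorm (g x)) - sinc (enorm (g x))) / enorm (g x)).
    deriv; first exact: lt0r_neq0.
    by rewrite sincE ?gt_eqF//; field; rewrite gt_eqF.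
  move: h; apply: near_eq_is_derive.
  by near=> r; rewrite sincE// gt_eqF//; near: r; exact: lt_nbhsr.
have hsn := is_diff_scalar_comp (g := fun z => enorm (g z)) hs he.
apply: is_diff_ext (is_diff_add (is_diff_scale hc hp) (is_diff_scale hsn hg)) _ => h.
have -> : sin (enorm (g x)) = sinc (enorm (g x)) * enorm (g x).
  by rewrite sincE ?gt_eqF// divfK// gt_eqF.
rewrite /exps_diff -enorm_sqr.
by apply/rowP => i; rewrite !mxE; field; rewrite gt_eqF.
Unshelve. all: by end_near. Qed.

End Retraction.

(** * Symmetry of second derivatives *)

Section Schwarz.
Variables (R : realType) (m : nat).
Local Notation V := ('rV[R]_m).

Lemma is_diff_dotpl (w : V) (x : V) : is_diff x (fun u => dotp u w) (fun u => dotp u w).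
Proof.
apply: is_diff_ext (is_diff_dotp (is_diff_id x) (is_diff_cst w x)) _ => h.
by rewrite dotp0r addr0.
Qed.

Lemma is_diff_line (f df : V -> R) (x u : V) (t : R) :
  is_diff (x + t *: u) f df -> is_derive t 1 (fun s : R => f (x + s *: u)) (df u).
Proof.
move=> hf.
have hl : is_diff t (fun s : R => x + s *: u) (fun s => s *: u).
  have h1 := is_diff_add (is_diff_cst x t)
    (is_diff_scale (is_diff_id t) (is_diff_cst u t)).
  apply: is_diff_ext h1 _ => h.
  by rewrite scaler0 addr0 add0r.
have [d dE] := is_diff_comp (g := f) hl hf.
split; first exact/derivable1_diffP.
have := deriveE (1 : R) d; rewrite dE /= scale1r => <- //.
Qed.

(** The mean value theorem along w turns the second difference into a difference
    of values of the gradient G at two points that differ by s u, to which the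
    differentiability of G at x applies. *)
Lemma second_difference (f : V -> R) (G dG : V -> V) (x u w : V) :
  (\forall z \near x, is_diff z f (dotp (G z))) -> is_diff x G dG ->
  forall e : R, 0 < e -> exists2 s0 : R, 0 < s0 &
  forall s, 0 < s < s0 ->
    `|f (x + s *: u + s *: w) - f (x + s *: u) - f (x + s *: w) + f x
      - s ^+ 2 * dotp (dG u) w| <= e * s ^+ 2.
Proof.
move=> hf hG e e0.
have [hGd hGE] := hG.
have [k k0 dk] : exists2 k : R, k > 0 & forall a : V, `|dotp a w| <= k * `|a|.
  have [d dE] := is_diff_dotpl w 0.
  have [k k0 dk] := linear_lipschitz (diff_continuous d).
  by exists k => // a; have := dk a; rewrite dE.
pose c := 2 * (`|u| + `|w| + 1).
have uw0 : 0 < `|u| + `|w| + 1 by rewrite ltr_wpDl// addr_ge0.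
have c0 : 0 < c by rewrite mulr_gt0.
have e1 : 0 < e / (k * c) by rewrite divr_gt0// mulr_gt0.
have rem := differentiable_remainder hGd e1.
have [r /= r0 hr] := (nbhs_ballP _ _).1 rem.
have [q /= q0 hq] := (nbhs_ballP _ _).1 hf.
exists (Num.min r q / (`|u| + `|w| + 1)); first by rewrite divr_gt0// lt_min r0.
move=> s /andP[s0]; rewrite ltr_pdivlMr// lt_min => /andP[sr sq].
have small (a b : R) : 0 <= a <= s -> 0 <= b <= s ->
    `|a *: u + b *: w| <= s * (`|u| + `|w| + 1).
  move=> /andP[a0 as_] /andP[b0 bs].
  apply: (le_trans (ler_normD _ _)); rewrite !normrZ !ger0_norm//.
  rewrite !mulrDr mulr1 -[leLHS]addr0 lerD ?(ltW s0)// lerD// ler_wpM2r//.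
have fd (a b : R) : 0 <= a <= s -> 0 <= b <= s ->
    is_diff (x + (a *: u + b *: w)) f (dotp (G (x + (a *: u + b *: w)))).
  move=> ha hb; apply: hq; rewrite -ball_normE /ball_ /= opprD addrA subrr sub0r normrN.
  exact: le_lt_trans (small _ _ ha hb) sq.
have remE (a b : R) : 0 <= a <= s -> 0 <= b <= s ->
    `|G (x + (a *: u + b *: w)) - G x - dG (a *: u + b *: w)|
      <= e / (k * c) * (s * (`|u| + `|w| + 1)).
  move=> ha hb; have h1 := small _ _ ha hb.
  have : ball 0 r (a *: u + b *: w).
    by rewrite -ball_normE /ball_ /= sub0r normrN (le_lt_trans h1).
  move=> /hr /=; rewrite [_ + x]addrC hGE => hle; apply: (le_trans hle).
  by rewrite ler_wpM2l// ltW.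
have ss : 0 <= s <= s by rewrite lexx ltW.
have s00 : 0 <= (0 : R) <= s by rewrite lexx ltW.
have d (t : R) : 0 <= t <= s -> is_derive t 1
    (fun b => f (x + s *: u + b *: w) - f (x + b *: w))
    (dotp (G (x + s *: u + t *: w)) w - dotp (G (x + (0 *: u + t *: w))) w).
  move=> ht.
  have F1 : is_diff (x + s *: u + t *: w) f (dotp (G (x + s *: u + t *: w))).
    by rewrite -addrA; exact: fd.
  have xE : x + (0 *: u + t *: w) = x + t *: w by rewrite scale0r add0r.
  have F2 : is_diff (x + t *: w) f (dotp (G (x + (0 *: u + t *: w)))).
    by rewrite -xE; exact: fd.
  exact: (is_derive_addS (is_diff_line F1) (is_derive_oppS (is_diff_line F2))).
have [t /andP[t0 ts]] := mean_value s0 d.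
rewrite -(addrA x _ (t *: w)) (scale0r w) !addr0 subr0.
have ht : 0 <= t <= s by rewrite !ltW.
set D := dotp _ w - _ => E.
have -> : f (x + s *: u + s *: w) - f (x + s *: u) - f (x + s *: w) + f x = D * s.
  rewrite -E; ring.
have dGlin : dG (s *: u + t *: w) - dG (0 *: u + t *: w) = s *: dG u.
  by rewrite -hGE -linearB/= scale0r add0r addrK linearZ.
have -> : D * s - s ^+ 2 * dotp (dG u) w = s * dotp
   ((G (x + (s *: u + t *: w)) - G x - dG (s *: u + t *: w)) -
    (G (x + (0 *: u + t *: w)) - G x - dG (0 *: u + t *: w))) w.
  have -> : (G (x + (s *: u + t *: w)) - G x - dG (s *: u + t *: w)) -
    (G (x + (0 *: u + t *: w)) - G x - dG (0 *: u + t *: w)) =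
    G (x + (s *: u + t *: w)) - G (x + (0 *: u + t *: w)) - s *: dG u.
    rewrite -dGlin; apply/rowP => i; rewrite !mxE; ring.
  rewrite /D !dotp_lin; ring.
rewrite normrM gtr0_norm// expr2 mulrA [_ * s in leRHS]mulrC.
apply: ler_wpM2l; first exact: ltW.
apply: (le_trans (dk _)).
apply: (@le_trans _ _ (k * (2 * (e / (k * c) * (s * (`|u| + `|w| + 1)))))).
  apply: ler_wpM2l; first exact: ltW.
  apply: (le_trans (ler_normB _ _)).
  by rewrite mulr_natl mulr2n lerD// remE.
rewrite le_eqVlt; apply/orP; left; apply/eqP; rewrite /c; field.
by rewrite !gt_eqF.
Qed.

(** The second difference is symmetric in u and w. *)
Lemma schwarz (f : V -> R) (G dG : V -> V) (x : V) :
  (\forall z \near x, is_diff z f (dotp (G z))) -> is_diff x G dG ->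
  forall u w, dotp (dG u) w = dotp (dG w) u.
Proof.
move=> hf hG u w; apply/eqP; rewrite -subr_eq0 -normr_le0.
apply/ler_addgt0Pr => e e0; rewrite add0r.
have e2 : 0 < e / 2 by rewrite divr_gt0.
have [s1 s10 h1] := second_difference u w hf hG e2.
have [s2 s20 h2] := second_difference w u hf hG e2.
pose s := Num.min s1 s2 / 2.
have m0 : 0 < Num.min s1 s2 by rewrite lt_min s10.
have s0 : 0 < s by rewrite divr_gt0.
have slt : s < Num.min s1 s2 by rewrite ltr_pdivrMr// ltr_pMr// ltr1n.
move: slt; rewrite lt_min => /andP[ss1 ss2].
have := h1 s; rewrite s0 ss1 => /(_ isT).
have := h2 s; rewrite s0 ss2 => /(_ isT).
have -> : x + s *: w + s *: u = x + s *: u + s *: w by rewrite addrAC.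
set A := f _ - _ - _ + _; set B := f _ - _ - _ + _.
have -> : A = B by rewrite /A /B; ring.
move=> H2 H1.
rewrite -(@ler_pM2l _ (s ^+ 2)) ?exprn_gt0//.
rewrite -{1}[s ^+ 2]ger0_norm ?sqr_ge0// -normrM.
have -> : s ^+ 2 * (dotp (dG u) w - dotp (dG w) u) =
   (B - s ^+ 2 * dotp (dG w) u) - (B - s ^+ 2 * dotp (dG u) w) by ring.
apply: (le_trans (ler_normB _ _)).
rewrite [leRHS](_ : _ = e / 2 * s ^+ 2 + e / 2 * s ^+ 2); last by field.
exact: lerD.
Qed.

End Schwarz.

(** * The Jacobian of a gradient map *)

Section Factor.
Variables (R : realType) (n : nat).
Local Notation V := ('rV[R]_n.+1).
Implicit Types (x y z u v h xi eta : V).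

Definition cost_hess_mx v : 'M[R]_n.+1 :=
  (1 - dotp v v / cost_ratio (enorm v))%:M + (cost_ratio (enorm v))^-1 *: (v^T *m v).

Lemma mul_cost_hess_mx v xi : xi *m cost_hess_mx v =
  (1 - dotp v v / cost_ratio (enorm v)) *: xi + (dotp v xi / cost_ratio (enorm v)) *: v.
Proof.
rewrite /cost_hess_mx mulmxDr mul_mx_scalar -scalemxAr mulmxA mul_dotp.
by rewrite mul_scalar_mx scalerA [dotp xi v]dotpC [_^-1 * _]mulrC.
Qed.

Lemma cost_hess_mxE v xi : dotp (xi *m cost_hess_mx v) xi = cost_hess v xi.
Proof.
rewrite mul_cost_hess_mx !dotp_lin /cost_hess /perp_form; ring.
Qed.

Lemma cost_hess_mx_sym v : (cost_hess_mx v)^T = cost_hess_mx v.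
Proof.
rewrite /cost_hess_mx [LHS]linearD/= tr_scalar_mx; congr (_ + _).
by rewrite [LHS]linearZ/= trmx_mul trmxK.
Qed.

(** For a gradient field eta is the ambient derivative of the gradient along xi,
    whose normal component is - <v, xi>; adding <v, xi> x leaves the Riemannian
    Hessian applied to xi.  The identity expresses the coefficients of x, v and
    xi through cos r = (1 - r^2 / q) sin r / r. *)
Lemma exps_diff_factor x v xi eta : dotp x x = 1 -> dotp x v = 0 ->
  dotp x xi = 0 -> dotp eta x = - dotp v xi -> enorm v < pi ->
  exps_diff x v xi eta =
  (eta + dotp v xi *: x + xi *m cost_hess_mx v) *m transport x v.
Proof.
move=> xx xv xxi etax vpi.
rewrite mulmx_transport mul_cost_hess_mx !dotp_lin etax xx.
rewrite [dotp xi x]dotpC xxi [dotp v x]dotpC xv !(mulr0, mulr1, addr0).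
rewrite addNr scale0r addr0 [dotp xi v]dotpC.
have [->|v0] := eqVneq v 0.
  rewrite /exps_diff enorm0 cos0 sinc0 !dotp0l !dotp0r.
  by apply/rowP => i; rewrite !mxE; ring.
have e0 := enorm_gt0 v0.
have Q0 := cost_ratio_enorm_gt0 v0 vpi.
have rpi : 0 < enorm v < pi by rewrite e0.
have s0 := sin_gt0_pi rpi; have P0 := sin_defect_gt0 rpi.
have vv : dotp v v = enorm v ^+ 2 by rewrite enorm_sqr.
have cE : cos (enorm v) = sinc (enorm v) - sinc (enorm v) / cost_ratio (enorm v) * dotp v v.
  move: P0; rewrite vv sincE ?gt_eqF// /cost_ratio /sin_defect => P0.
  by field; rewrite !gt_eqF.
rewrite /exps_diff cE.
apply/rowP => i; rewrite !mxE [dotp v eta]dotpC.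
have d0 := dotp_gt0 v0.
by field; rewrite !gt_eqF.
Qed.

End Factor.

Section SphereCalculus.
Variables (R : realType) (n : nat).
Local Notation V := ('rV[R]_n.+1).
Implicit Types (x y z u v h xi eta : V).

Variable psi : V -> R.
Hypothesis psi_diff : forall y, usphere y -> sdifferentiable (psi : _ -> R^o) y.

Local Notation f := (psi \o @retr R n).
Local Notation g := (sgrad psi \o @retr R n).

Lemma is_diff_sphere y : usphere y -> is_diff y f (dotp (sgrad psi y)).
Proof.
move=> yS; have df : differentiable (f : V -> R) y := psi_diff yS.
split=> //; apply/funext => h; rewrite {1}[h]row_sum_delta linear_sum /= dotpE.
apply: eq_bigr => i _; rewrite linearZ /sgrad mxE -deriveE// mulrC.
by [].
Qed.

(** The function psi \o retr does not change under a further composition with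
    retr, whose differential at y kills y. *)
Lemma sgrad_tangent y : usphere y -> dotp y (sgrad psi y) = 0.
Proof.
move=> yS; have hf := is_diff_sphere yS.
have fE : f = f \o @retr R n by apply/funext => z; rewrite /= retr_retr.
have hf' : is_diff (retr y) f (dotp (sgrad psi y)) by rewrite retr_id.
have hc := is_diff_comp (is_diff_retr_unit yS) hf'.
rewrite -fE in hc.
have := congr1 (fun d => d y) (is_diff_unique hf hc).
rewrite /= usphere_dotp// scale1r subrr dotp0r dotpC //.
Qed.

(** As psi \o retr is constant along rays, its gradient at z is that at the
    point retr z of the sphere, divided by |z|. *)
Lemma is_diff_ray z : z != 0 ->
  is_diff z f (dotp ((enorm z)^-1 *: g z)).
Proof.
move=> z0; have e0 := enorm_gt0 z0.
pose l := (enorm z)^-1; have l0 : 0 < l by rewrite invr_gt0.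
have fE : f = f \o (fun u => l *: u) by apply/funext => u; rewrite /= retrZ.
have hl : is_diff z (fun u => l *: u) (fun u => l *: u) := is_diff_scaler l z.
have hf : is_diff (l *: z) f (dotp (sgrad psi (l *: z))).
  exact: is_diff_sphere (retr_usphere z0).
rewrite fE; apply: is_diff_ext (is_diff_comp hl hf) _ => h.
by rewrite /= dotpZr dotpZl.
Qed.

Variables (x : V) (dg : V -> V).
Hypothesis xS : usphere x.
Hypothesis hg : is_diff x g dg.

Let v := sgrad psi x.

Lemma near_neq0 : \forall z \near x, z != 0.
Proof.
have hx : (id : V -> V) @ x --> x by exact: cvg_id.
exact: cvgr_neq0 hx (usphere_neq0 xS).
Qed.

Lemma dgrad_normal xi : dotp x xi = 0 -> dotp (dg xi) x = - dotp v xi.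
Proof.
move=> xxi; have hF := is_diff_dotp hg (is_diff_retr_unit xS).
have [Fd FE] := hF.
have : 'D_xi (fun z => dotp (g z) (retr z)) x = 'D_xi (cst (0 : R)) x.
  apply: near_eq_derive; near=> z.
  have z0 : z != 0 by near: z; exact: near_neq0.
  by rewrite /= dotpC sgrad_tangent//; exact: retr_usphere.
rewrite derive_cst deriveE// FE /= retr_id// xxi scale0r subr0 => /eqP.
by rewrite addr_eq0 => /eqP.
Unshelve. all: by end_near. Qed.

(** The gradient of psi \o retr near x is g z / |z|, and the factor 1 / |z| is
    stationary in tangent directions, so that dg inherits the symmetry of
    second derivatives. *)
Lemma dgrad_sym xi zeta : dotp x xi = 0 -> dotp x zeta = 0 ->
  dotp (dg xi) zeta = dotp (dg zeta) xi.
Proof.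
move=> xxi xzeta.
have h1 := is_diff_enorm (usphere_neq0 xS) (is_diff_id x).
have h2 : is_derive (enorm x) 1 (fun r : R => r^-1) (- (enorm x) ^- 2 * 1).
  apply: (is_derive_invS _ (is_derive_idS _)).
  by rewrite gt_eqF// enorm_gt0// usphere_neq0.
have hG := is_diff_scale (is_diff_scalar_comp (g := fun z => enorm z) h2 h1) hg.
have hn : \forall z \near x, is_diff z f (dotp ((enorm z)^-1 *: g z)).
  by near=> z; apply: is_diff_ray; near: z; exact: near_neq0.
have := schwarz hn hG xi zeta.
by rewrite xxi xzeta !mul0r !scale0r !add0r xS invr1 !scale1r.
Unshelve. all: by end_near. Qed.

End SphereCalculus.

Lemma derive_exps_retr (R : realType) (n : nat) (g dg : 'rV[R]_n.+1 -> 'rV[R]_n.+1)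
    (x xi : 'rV[R]_n.+1) : usphere x -> is_diff x g dg -> dotp x xi = 0 ->
  xi *m jacobian (fun z => exps (retr z) (g z)) x = exps_diff x (g x) xi (dg xi).
Proof.
move=> xS hg xxi; have [Gd GdE] := is_diff_exps (is_diff_retr_unit xS) hg.
rewrite -(deriveEjacobian _ Gd) (deriveE _ Gd) GdE.
by rewrite (retr_id xS) xxi scale0r subr0.
Qed.

Section JacobianFormula.
Variables (R : realType) (n : nat).
Local Notation V := ('rV[R]_n.+2).

Definition hess_mx (E : 'M[R]_(n.+1, n.+2)) (D : 'M[R]_n.+2) (v : V) :=
  E *m (D + cost_hess_mx v) *m E^T.

Lemma qform_hess_mx E D v (u : 'rV_n.+1) :
  qform (hess_mx E D v) u =
  dotp (u *m E *m D) (u *m E) + cost_hess v (u *m E).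
Proof.
rewrite -cost_hess_mxE -dotpDl -mulmxDr /qform /hess_mx /dotp !trmx_mul.
by rewrite !mulmxA.
Qed.

(** The frame at x splits off the Hessian, and [det_frames] removes the frames
    from the remaining factor [transport].  The manifold has dimension n + 1,
    hence the exponent n. *)
Lemma Jac_gradient_map (psi : V -> R) (x : V) :
  (forall y, usphere y -> sdifferentiable (psi : _ -> R^o) y) ->
  usphere x -> sdifferentiable (sgrad psi) x -> enorm (sgrad psi x) < pi ->
  Jac (gradient_map psi) x =
  \det (hess_mx (frame x) (jacobian (sgrad psi \o @retr R n.+1) x) (sgrad psi x))
  * sinc (enorm (sgrad psi x)) ^+ n.
Proof.
move=> psid xS gd vpi; set v := sgrad psi x; set g := sgrad psi \o _.
have xv : dotp x v = 0 by exact: sgrad_tangent.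
have xx := usphere_dotp xS.
have yS : usphere (gradient_map psi x) by exact: exps_usphere.
have oE := frame_oriented xS; have oF := frame_oriented yS.
rewrite /Jac; set E := frame x in oE *; set F := frame _ in oF *.
have [EE Ex _] := oE.
have hg : is_diff x g ('d g x) by exact: differentiableP.
have GE : gradient_map psi \o @retr R n.+1 = fun z => exps (retr z) (g z) by [].
have gx : g x = v by rewrite /g /= retr_id.
have EJ : E *m jacobian (gradient_map psi \o @retr R n.+1) x =
    hess_mx E (jacobian g x) v *m E *m transport x v.
  apply/row_matrixP => i; rewrite !row_mul.
  set xi := row i E.
  have xxi : dotp x xi = 0.
    rewrite dotpC; have := congr1 (fun M : 'M[R]_(_, _) => M i 0) Ex.
    by rewrite mxE mxE /dotp => <-; rewrite !mxE; apply: eq_bigr => j _; rewrite !mxE.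
  rewrite GE (derive_exps_retr xS hg xxi) gx.
  have nE := dgrad_normal psid xS hg xxi.
  rewrite (exps_diff_factor xx xv xxi nE vpi); congr (_ *m _).
  set w := (_ + _ + _).
  have wx : dotp w x = 0.
    rewrite /w !dotp_lin nE xx mulr1 addNr add0r.
    by rewrite mul_cost_hess_mx !dotp_lin [dotp xi x]dotpC xxi [dotp _ x]dotpC xv !mulr0 addr0.
  rewrite -[LHS](frame_proj xS oE wx); congr (_ *m _).
  have JE : xi *m jacobian g x = 'd g x xi by rewrite /jacobian mul_rV_lin1.
  rewrite /w (mulmxDr xi (jacobian g x)) JE.
  rewrite !mulmxDl -scalemxAl (_ : x *m E^T = 0) ?scaler0 ?addr0//.
  by rewrite -[LHS]trmxK trmx_mul trmxK Ex trmx0.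
rewrite EJ -(mulmxA _ E) -(mulmxA _ (E *m _)) det_mulmx.
rewrite (det_frames xS yS oE oF)// ?det_transport//.
rewrite mulmx_transport xx xv scale1r scale0r addr0 /gradient_map expsE.
by rewrite addrA -scalerDl [_ + (_ - _)]addrC subrK.
Qed.

End JacobianFormula.

(** * Contact points of a c-convex function *)

Section Contact.
Variables (R : realType) (n : nat).
Local Notation V := ('rV[R]_n.+1).
Implicit Types (x y z : V).

Lemma dotp_usphere_itv x y : usphere x -> usphere y -> -1 <= dotp x y <= 1.
Proof.
move=> xS yS; have := dotp_le_enorm x y; have := dotp_le_enorm (- x) y.
rewrite -scaleN1r enormZ normrN1 mul1r dotpZl mulN1r xS yS mulr1 => h1 h2.
by rewrite h2 andbT lerNl.
Qed.

Lemma dotp_continuous x : continuous (dotp x).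
Proof.
move=> y; apply: differentiable_continuous.
by case: (is_diff_dotp (is_diff_cst x y) (is_diff_id y)).
Qed.

Lemma usphere_compact : compact (@usphere R n).
Proof.
have box : compact [set v : V | forall i, `[(-1 : R), 1]%classic (v ord0 i)].
  apply: (@rV_compact R n.+1 (fun=> `[(-1 : R), 1]%classic)) => i.
  exact: segment_compact.
apply: (subclosed_compact _ box); last first.
  move=> v vS i; rewrite /= in_itv/=.
  have := usphere_dotp vS; rewrite dotpE (bigD1 i)//= => h.
  have : 0 <= \sum_(j < n.+1 | j != i) v 0 j * v 0 j.
    by rewrite sumr_ge0// => j _; rewrite -expr2 sqr_ge0.
  rewrite -ler_norml => h1; rewrite -(@ler_pXn2r _ 2)// ?nnegrE//.
  by rewrite real_normK ?num_real// expr1n expr2; lra.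
have -> : @usphere R n = (fun v => dotp v v) @^-1` [set 1].
  by apply/seteqP; split=> v /=; [exact: usphere_dotp|exact: dotp_usphere].
apply: closed_comp => [v _|]; last exact: closed_eq.
apply: differentiable_continuous.
by case: (is_diff_dotp (is_diff_id v) (is_diff_id v)).
Qed.

(** Outside of [-1, 1] the arc cosine takes default values, so continuity at the
    end points is one-sided. *)
Lemma acos_within_continuous : {within `[(-1 : R), 1], continuous (@acos R)}.
Proof.
have := @segment_can_ge_continuous R 0 pi cos acos (pi_ge0 R).
rewrite cospi cos0; apply; last exact: cosK.
exact/continuous_subspaceT/continuous_cos.
Qed.

Lemma cost_near x y (e : R) : usphere x -> usphere y -> 0 < e ->
  \forall y' \near y, usphere y' -> `|cost x y - cost x y'| < e.
Proof.
move=> xS yS e0.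
have c2 : {within `[(-1 : R), 1], continuous (fun r : R => 2^-1 * acos r ^+ 2)}.
  move=> r; apply: (@continuous_comp (subspace `[(-1 : R), 1]) R R (@acos R)
    (fun a => 2^-1 * a ^+ 2)); first exact: acos_within_continuous.
  have d : is_derive (acos r) 1 (fun a : R => 2^-1 * a ^+ 2) (acos r).
    by deriv; field.
  exact: is_derive_cvg d.
have /subspace_continuousP/(_ (dotp x y)) := c2.
rewrite /= in_itv/= dotp_usphere_itv// => /(_ isT)/cvgrPdist_lt/(_ e e0).
rewrite near_withinE => h.
have hd : \forall y' \near y, `[(-1 : R), 1]%classic (dotp x y') ->
  `|2^-1 * acos (dotp x y) ^+ 2 - 2^-1 * acos (dotp x y') ^+ 2| < e.
  exact: (@dotp_continuous x y _ h).
near=> y' => y'S; have := near hd y'; apply=> //.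
by rewrite /= in_itv/= dotp_usphere_itv.
Unshelve. all: by end_near.
Qed.

Lemma costC x y : cost x y = cost y x.
Proof. by rewrite /cost /geodist dotpC. Qed.

(** As phi x is the supremum of - c(x, y) - phi^c(y) over y, it is enough to take
    y that almost attains it. *)
Lemma c_convex_near_contact (phi : V -> R) x (e : R) : c_convex phi ->
  usphere x -> 0 < e -> exists2 y, usphere y &
    forall z, usphere z -> phi x + cost x y - e <= phi z + cost z y.
Proof.
move=> cc xS e0; have := cc x xS.
set T := ctransform _ => TE.
have : ((phi x - e)%:E < T x)%E by rewrite TE lte_fin ltrBlDr ltrDl.
move=> /ereal_sup_gt[_ /= [y yS <-]] h.
exists y => // z zS.
have : ((- cost z y)%:E - (phi z)%:E <= ctransform (EFin \o phi) y)%E.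
  by apply: ereal_sup_ubound => /=; exists z.
move: h; case: (ctransform _ y) => [r| |] //=.
rewrite -!EFinB lte_fin lee_fin costC [cost x y]costC; lra.
Qed.

(** The sets of approximate contact points are nested and nonempty; a cluster
    point of the filter that they generate is a contact point. *)
Lemma c_convex_contact (phi : V -> R) x : c_convex phi -> usphere x ->
  exists2 y, usphere y &
    forall z, usphere z -> phi x + cost x y <= phi z + cost z y.
Proof.
move=> cc xS.
pose B (e : R) : set V := [set y | usphere y /\
  forall z, usphere z -> phi x + cost x y - e <= phi z + cost z y].
pose F := filter_from [set e : R | 0 < e] B.
have FF : Filter F.
  apply: filter_from_filter; first by exists 1 => /=.
  move=> i j /= i0 j0; exists (Num.min i j); first by rewrite /= lt_min i0.
  move=> y [yS h]; split; split=> // z zS; apply: le_trans (h z zS).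
    by rewrite lerB// ge_min lexx.
  by rewrite lerB// ge_min lexx orbT.
have PF : ProperFilter F.
  apply: filter_from_proper => e e0.
  by have [y yS h] := c_convex_near_contact cc xS e0; exists y.
have FS : F (@usphere R n) by exists 1 => //= y [].
have [y [yS cl]] := usphere_compact PF FS.
exists y => // z zS.
apply/ler_addgt0Pr => e e0.
have e3 : 0 < e / 3 by rewrite divr_gt0.
have FB : F (B (e / 3)) by exists (e / 3).
have nx := cost_near xS yS e3; have nz := cost_near zS yS e3.
have [y' [[y'S h] [hx hz]]] := cl _ _ FB (filterI nx nz).
have := h z zS; have := hx y'S; have := hz y'S.
rewrite !ltr_norml => /andP[? ?] /andP[? ?] ?; lra.
Qed.

End Contact.

(** * Derivatives of the cost along great circles *)

Section SecondOrder.
Variable R : realType.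
Implicit Types (s t p e r : R).

Lemma derive_of_diff (F d : R -> R) (s : R) : is_diff s F d -> is_derive s 1 F (d 1).
Proof.
move=> [dF dE]; split; first exact/derivable1_diffP.
by rewrite deriveE// dE.
Qed.

Lemma first_order_min (F : R -> R) (d : R) : is_derive (0 : R) 1 F d ->
  (\forall s \near (0 : R), derivable F s 1) ->
  (\forall s \near (0 : R), F 0 <= F s) -> d = 0.
Proof.
move=> hd hF hmin.
have [q /= q0 hq] := (nbhs_ballP _ _).1 (filterI hF hmin).
have ballE (s : R) : `|s| < q -> derivable F s 1 /\ F 0 <= F s.
  by move=> sd; apply: hq; rewrite -ball_normE /ball_ /= sub0r normrN.
have h0 : is_derive (0 : R) 1 F 0.
  apply: (@derive1_at_min R F (- q) q 0).
  - by move: q0; clear; lra.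
  - by move=> t; rewrite in_itv/= -ltr_norml => /ballE[].
  - by rewrite in_itv/= oppr_lt0 q0.
  - by move=> t; rewrite in_itv/= -ltr_norml => /ballE[].
by rewrite -(@derive_val _ _ _ _ _ _ _ hd) (@derive_val _ _ _ _ _ _ _ h0).
Qed.

Lemma second_order_min (F F1 : R -> R) (F2 : R) :
  (\forall s \near (0 : R), is_derive (s : R) 1 F (F1 s)) -> is_derive (0 : R) 1 F1 F2 ->
  (\forall s \near (0 : R), F 0 <= F s) -> 0 <= F2.
Proof.
move=> hF hF1 hmin.
have F10 : F1 0 = 0.
  apply: first_order_min hmin; first exact: nbhs_singleton hF.
  by apply: filterS hF => s [].
have [d /= d0 hd] := (nbhs_ballP _ _).1 (filterI hF hmin).
have ballE (s : R) : `|s| < d -> is_derive s 1 F (F1 s) /\ F 0 <= F s.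
  by move=> sd; apply: hd; rewrite -ball_normE /ball_ /= sub0r normrN.
rewrite leNgt; apply/negP => F2n.
have [F1d F1E] := is_diff_of_derive hF1.
have e0 : 0 < - F2 / 2 by rewrite divr_gt0// oppr_gt0.
have rem := differentiable_remainder F1d e0.
have [q /= q0 hq] := (nbhs_ballP _ _).1 rem.
have m0 : 0 < Num.min d q by rewrite lt_min d0.
pose h := Num.min d q / 2.
have h0 : 0 < h by rewrite divr_gt0.
have : h < Num.min d q by rewrite ltr_pdivrMr// ltr_pMr// ltr1n.
rewrite lt_min => /andP[hd' hq'].
have dv (s : R) : 0 <= s <= h -> is_derive s 1 F (F1 s).
  move=> /andP[s0 sh]; have [|//] := ballE s.
  by rewrite ger0_norm// (le_lt_trans sh).
have [c /andP[c0 ch] E] := mean_value h0 dv.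
have cq : ball 0 q c.
  by rewrite -ball_normE /ball_ /= sub0r normrN gtr0_norm// (lt_trans ch).
have := hq _ cq; rewrite /= addr0 F10 subr0 F1E (gtr0_norm c0) ler_norml => /andP[_ le].
have F1c : F1 c < 0.
  have : c * F2 < 0 by rewrite pmulr_rlt0.
  lra.
have [|_ Fh] := ballE h; first by rewrite gtr0_norm.
by move: Fh; rewrite -subr_ge0 E subr0 pmulr_lge0// leNgt F1c.
Qed.

Lemma is_derive_sqrtS (f : R -> R) (s d : R) : 0 < f s -> is_derive s 1 f d ->
  is_derive s 1 (fun y => Num.sqrt (f y)) ((2 * Num.sqrt (f s))^-1 * d).
Proof. by move=> f0 h; exact: (is_derive1_comp (is_derive1_sqrt f0) h). Qed.

Lemma is_derive_acosS (f : R -> R) (s d : R) : -1 < f s < 1 -> is_derive s 1 f d ->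
  is_derive s 1 (fun y => acos (f y)) (- (Num.sqrt (1 - f s ^+ 2))^-1 * d).
Proof. by move=> f0 h; exact: (is_derive1_comp (is_derive1_acos f0) h). Qed.

(** With p = <x, y> and e = <xi, y>, these are <z, y>, c(z, y) and their
    derivatives at the point z = cos s x + sin s xi of a great circle. *)
Definition gcos p e s : R := cos s * p + sin s * e.
Definition gcos' p e s : R := cos s * e - sin s * p.
Definition gcost p e s : R := 2^-1 * acos (gcos p e s) ^+ 2.
Definition gcost' p e s : R :=
  - (acos (gcos p e s) * (gcos' p e s / Num.sqrt (1 - gcos p e s ^+ 2))).

Lemma is_derive_gcos (p e s : R) : is_derive s 1 (gcos p e) (gcos' p e s).
Proof. by rewrite /gcos /gcos'; deriv; ring. Qed.

Lemma is_derive_gcos' p e s : is_derive s 1 (gcos' p e) (- gcos p e s).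
Proof. by rewrite /gcos /gcos'; deriv; ring. Qed.

Lemma gcos0 p e : gcos p e 0 = p.
Proof. by rewrite /gcos cos0 sin0; ring. Qed.

Lemma gcos'0 p e : gcos' p e 0 = e.
Proof. by rewrite /gcos' cos0 sin0; ring. Qed.

Lemma is_derive_gcost (p e s : R) : -1 < gcos p e s < 1 ->
  is_derive s 1 (gcost p e) (gcost' p e s).
Proof.
move=> h; have hA := is_derive_acosS h (is_derive_gcos p e s).
have q0 : Num.sqrt (1 - gcos p e s ^+ 2) != 0.
  rewrite gt_eqF// sqrtr_gt0.
  by move: (gcos p e s) h => c /andP[c0 c1]; nra.
by rewrite /gcost /gcost'; deriv; field.
Qed.

Lemma gcos_near p e : -1 < p < 1 -> \forall s \near (0 : R), -1 < gcos p e s < 1.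
Proof.
move=> /andP[p0 p1].
have c : gcos p e @ (0 : R) --> p.
  by rewrite -{2}(gcos0 p e); exact: is_derive_cvg (is_derive_gcos p e 0).
near=> s; apply/andP; split; near: s.
- exact: (cvgr_gt _ c).
- exact: (cvgr_lt _ c).
Unshelve. all: by end_near. Qed.

Lemma is_derive_gcost' p e : -1 < p < 1 -> let r := acos p in
  is_derive (0 : R) 1 (gcost' p e)
    (e ^+ 2 / sin r ^+ 2 + r * cos r / sin r - r * e ^+ 2 * cos r / sin r ^+ 3).
Proof.
move=> p11 r; have /andP[p0 p1] := p11.
have p01 : -1 <= p <= 1 by rewrite !ltW.
have pE : cos r = p by rewrite acosK// in_itv/=.
have r0 : 0 < r by rewrite acos_gt0// p1 ltW.
have rpi : r < pi by rewrite acos_ltpi// p0 ltW.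
have s0 : 0 < sin r by rewrite sin_gt0_pi// r0.
have sq : Num.sqrt (1 - p ^+ 2) = sin r by rewrite sin_acos.
have q0 : 0 < 1 - gcos p e 0 ^+ 2.
  by rewrite gcos0 -pE -sin2cos2 exprn_gt0.
have g0 : -1 < gcos p e 0 < 1 by rewrite gcos0.
have hC := is_derive_gcos p e 0; have hC' := is_derive_gcos' p e 0.
have hA := is_derive_acosS g0 hC.
have hq : is_derive (0 : R) 1 (fun s => 1 - gcos p e s ^+ 2)
    (- (2 * gcos p e 0 * gcos' p e 0)) by deriv; ring.
have hS := is_derive_sqrtS (f := fun s => 1 - gcos p e s ^+ 2) q0 hq.
rewrite /gcost'; deriv; first by rewrite gcos0 sq gt_eqF.
rewrite gcos0 gcos'0 sq -/r -pE.
by field; rewrite gt_eqF.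
Qed.

End SecondOrder.

(** * First and second order conditions at a contact point *)

Section GreatCircles.
Variables (R : realType) (n : nat).
Local Notation V := ('rV[R]_n.+1).
Implicit Types (x y z xi : V).

Definition circ x xi (s : R) : V := cos s *: x + sin s *: xi.
Definition circ' x xi (s : R) : V := - sin s *: x + cos s *: xi.

Lemma circ0 x xi : circ x xi 0 = x.
Proof. by rewrite /circ cos0 sin0 scale1r scale0r addr0. Qed.

Lemma circ'0 x xi : circ' x xi 0 = xi.
Proof. by rewrite /circ' cos0 sin0 oppr0 scale1r scale0r add0r. Qed.

Lemma is_diff_circ x xi s : is_diff s (circ x xi) (fun h => h *: circ' x xi s).
Proof.
have hc := is_diff_scale (is_diff_of_derive (is_derive_cos s)) (is_diff_cst x s).
have hs := is_diff_scale (is_diff_of_derive (is_derive_sin s)) (is_diff_cst xi s).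
apply: is_diff_ext (is_diff_add hc hs) _ => h.
by rewrite !scaler0 !addr0 /circ' scalerDr !scalerA.
Qed.

Lemma is_diff_circ' x xi s : is_diff s (circ' x xi) (fun h => h *: (- circ x xi s)).
Proof.
have d : is_derive s 1 (fun s : R => - sin s) (- cos s).
  by deriv; ring.
have hs := is_diff_scale (is_diff_of_derive d) (is_diff_cst x s).
have hc := is_diff_scale (is_diff_of_derive (is_derive_cos s)) (is_diff_cst xi s).
apply: is_diff_ext (is_diff_add hs hc) _ => h.
by rewrite !scaler0 !addr0 /circ opprD scalerDr -!scaleNr !scalerA.
Qed.

Variables (x xi : V).
Hypothesis xS : usphere x.
Hypothesis xiS : usphere xi.
Hypothesis xxi : dotp x xi = 0.

Lemma circ_usphere s : usphere (circ x xi s).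
Proof.
apply: dotp_usphere; rewrite /circ !dotp_lin (usphere_dotp xS) (usphere_dotp xiS).
by rewrite [dotp xi x]dotpC xxi -[RHS](cos2Dsin2 s); ring.
Qed.

Lemma cost_circ y s : cost (circ x xi s) y = gcost (dotp x y) (dotp xi y) s.
Proof. by rewrite /cost /geodist /gcost /gcos /circ !dotp_lin. Qed.

Variable psi : V -> R.
Hypothesis psi_diff : forall y, usphere y -> sdifferentiable (psi : _ -> R^o) y.

Lemma is_derive_circ (s : R) : is_derive s 1 (fun s => psi (circ x xi s))
  (dotp (sgrad psi (circ x xi s)) (circ' x xi s)).
Proof.
have -> : (fun s => psi (circ x xi s)) = (psi \o @retr R n) \o circ x xi.
  by apply/funext => t; rewrite /= retr_id//; exact: circ_usphere.
have hc := is_diff_comp (is_diff_circ x xi s) (is_diff_sphere psi_diff (circ_usphere s)).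
have := derive_of_diff hc.
by rewrite /= scale1r.
Qed.

(** The acceleration of a great circle through x is - x, which is orthogonal to
    the gradient; hence the second derivative is the Hessian. *)
Lemma is_derive_circ' (dg : V -> V) :
  is_diff x (sgrad psi \o @retr R n) dg ->
  is_derive (0 : R) 1 (fun s => dotp (sgrad psi (circ x xi s)) (circ' x xi s))
    (dotp (dg xi) xi).
Proof.
move=> hg.
have -> : (fun s => dotp (sgrad psi (circ x xi s)) (circ' x xi s)) =
    fun s => dotp ((sgrad psi \o @retr R n) (circ x xi s)) (circ' x xi s).
  by apply/funext => t; rewrite /= retr_id//; exact: circ_usphere.
have hg' : is_diff (circ x xi 0) (sgrad psi \o @retr R n) dg by rewrite circ0.
have hc := is_diff_comp (is_diff_circ x xi 0) hg'.
have := derive_of_diff (is_diff_dotp hc (is_diff_circ' x xi 0)).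
rewrite /= !scale1r circ'0 circ0 retr_id// dotpNr.
by rewrite [dotp (sgrad _ _) x]dotpC (sgrad_tangent psi_diff xS) subr0.
Qed.

End GreatCircles.

Section ContactConditions.
Variables (R : realType) (n : nat).
Local Notation V := ('rV[R]_n.+1).
Implicit Types (z xi : V).
Variables (psi : V -> R) (x y : V).
Hypothesis psi_diff : forall y, usphere y -> sdifferentiable (psi : _ -> R^o) y.
Hypothesis xS : usphere x.
Hypothesis yS : usphere y.
Hypothesis contact : forall z, usphere z -> psi x + cost x y <= psi z + cost z y.

Let v := sgrad psi x.
Let p := dotp x y.

Lemma unit_eq u w : @usphere R n u -> usphere w -> dotp u w = 1 -> u = w.
Proof.
move=> /usphere_dotp uu /usphere_dotp ww uw; apply/eqP; rewrite -subr_eq0.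
by apply/eqP/dotp_eq0; rewrite !dotp_lin uu ww [dotp w u]dotpC uw; ring.
Qed.

Lemma tangent_eq0 (w : V) : dotp x w = 0 ->
  (forall xi, usphere xi -> dotp x xi = 0 -> dotp w xi = 0) -> w = 0.
Proof.
move=> xw h; have [//|w0] := eqVneq w 0.
have e0 := enorm_gt0 w0.
have := h ((enorm w)^-1 *: w) (retr_usphere w0).
rewrite dotpZr xw mulr0 => /(_ erefl)/eqP.
by rewrite dotpZr -enorm_sqr mulf_eq0 invr_eq0 sqrf_eq0 orbb gt_eqF.
Qed.

Lemma contact_circ xi s : usphere xi -> dotp x xi = 0 ->
  psi (circ x xi 0) + gcost p (dotp xi y) 0 <=
  psi (circ x xi s) + gcost p (dotp xi y) s.
Proof.
move=> xiS xxi; rewrite -!cost_circ circ0; apply: contact.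
exact: circ_usphere.
Qed.

(** If y = -x then c(z, y) = (pi - s)^2 / 2 at distance s from x, and the contact
    inequality at s and - s contradicts the differentiability of psi. *)
Lemma contact_not_antipodal xi : usphere xi -> dotp x xi = 0 -> p != -1.
Proof.
move=> xiS xxi; apply/eqP => pm.
have e0 : dotp xi y = 0.
  have -> : y = - x.
    apply: unit_eq => //; last by rewrite dotpNr dotpC -/p pm opprK.
    by apply: dotp_usphere; rewrite dotpNl dotpNr opprK usphere_dotp.
  by rewrite dotpNr dotpC xxi oppr0.
have hcost s : 0 <= s <= pi -> gcost p (dotp xi y) s = 2^-1 * (pi - s) ^+ 2.
  move=> s0pi; rewrite /gcost /gcos pm e0 mulr0 addr0 mulrN1.
  by rewrite acosN ?cos_geN1 ?cos_le1// cosK// in_itv/=.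
have hcostN s : gcost p (dotp xi y) (- s) = gcost p (dotp xi y) s.
  by rewrite /gcost /gcos cosN e0 !mulr0.
have hd := is_derive_circ xS xiS xxi psi_diff 0.
have [Fd FE] := is_diff_of_derive hd.
have rem := differentiable_remainder Fd (ltr01 : 0 < (1 : R)).
have [q /= q0 hq] := (nbhs_ballP _ _).1 rem.
have m0 : 0 < Num.min 1 q by rewrite lt_min ltr01.
pose s := Num.min 1 q / 2.
have s0 : 0 < s by rewrite divr_gt0.
have : s < Num.min 1 q by rewrite ltr_pdivrMr// ltr_pMr// ltr1n.
rewrite lt_min => /andP[s1 sq].
have spi : 0 <= s <= pi.
  by rewrite ltW// ltW// (lt_trans s1)// (lt_le_trans _ (pi_ge2 R))// ltr1n.
have pi2 := pi_ge2 R.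
have b1 : ball (0 : R) q s by rewrite -ball_normE /ball_ /= sub0r normrN gtr0_norm.
have b2 : ball (0 : R) q (- s) by rewrite -ball_normE /ball_ /= sub0r opprK gtr0_norm.
have := hq _ b1; have := hq _ b2.
rewrite /= !addr0 FE normrN (gtr0_norm s0) mul1r !ler_norml.
move=> /andP[_ h1] /andP[_ h2].
have := contact_circ s xiS xxi; have := contact_circ (- s) xiS xxi.
rewrite hcostN !hcost ?lexx ?pi_ge0// => h3 h4.
move: h1 h2 h3 h4.
move: (psi (circ x xi 0)) (psi (circ x xi s)) (psi (circ x xi (- s))) => a b c.
move: (dotp _ _) => d h1 h2 h3 h4.
have : (2 * pi - s) * s <= 2 * s by nra.
rewrite ler_pM2r// => h5; lra.
Qed.

(** If y = x then c(z, y) = s^2 / 2 near x. *)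
Lemma contact_coincide : p = 1 -> v = 0 /\
  forall xi (dg : V -> V), usphere xi -> dotp x xi = 0 ->
    is_diff x (sgrad psi \o @retr R n) dg -> 0 <= dotp (dg xi) xi + 1.
Proof.
move=> p1; have xy : x = y by exact: unit_eq.
have hmin xi : usphere xi -> dotp x xi = 0 -> \forall s \near (0 : R),
    psi (circ x xi 0) + 2^-1 * 0 ^+ 2 <= psi (circ x xi s) + 2^-1 * s ^+ 2.
  move=> xiS xxi.
  have hcost s : `|s| <= pi -> gcost p (dotp xi y) s = 2^-1 * s ^+ 2.
    move=> spi; rewrite /gcost /gcos p1 -xy dotpC xxi mulr0 addr0 mulr1.
    by rewrite -cos_norm cosK ?in_itv/= ?normr_ge0// real_normK ?num_real.
  near=> s; have := contact_circ s xiS xxi.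
  rewrite !hcost ?normr0 ?pi_ge0//.
  near: s; apply/nbhs_ballP; exists pi => /=; first exact: pi_gt0.
  by move=> s; rewrite -ball_normE /ball_ /= sub0r normrN => /ltW.
have hd xi : usphere xi -> dotp x xi = 0 -> forall s : R,
    is_derive s 1 (fun s => psi (circ x xi s) + 2^-1 * s ^+ 2)
      (dotp (sgrad psi (circ x xi s)) (circ' x xi s) + s).
  move=> xiS xxi s; have h := is_derive_circ xS xiS xxi psi_diff s.
  by deriv; field.
split.
  apply: tangent_eq0; first exact: sgrad_tangent.
  move=> xi xiS xxi.
  have := first_order_min (hd xi xiS xxi 0) _ (hmin xi xiS xxi).
  rewrite circ0 circ'0 addr0; apply.
  by near=> s; case: (hd xi xiS xxi s).
move=> xi dg xiS xxi hg.
have h' := is_derive_circ' xS xiS xxi psi_diff hg.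
have h2 : is_derive (0 : R) 1
    (fun s => dotp (sgrad psi (circ x xi s)) (circ' x xi s) + s) (dotp (dg xi) xi + 1).
  by deriv.
have hn : \forall s \near (0 : R),
    is_derive (s : R) 1 (fun s => psi (circ x xi s) + 2^-1 * s ^+ 2)
      (dotp (sgrad psi (circ x xi s)) (circ' x xi s) + s).
  by near=> s; exact: hd.
exact: second_order_min hn h2 (hmin xi xiS xxi).
Unshelve. all: by end_near. Qed.

Lemma contact_generic : -1 < p < 1 -> let r := acos p in
  [/\ enorm v = r, 0 < r < pi &
  forall xi (dg : V -> V), usphere xi -> dotp x xi = 0 ->
    is_diff x (sgrad psi \o @retr R n) dg ->
    0 <= dotp (dg xi) xi + cost_hess v xi].
Proof.
move=> p11 r; have /andP[p0 p1] := p11.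
have p01 : -1 <= p <= 1 by rewrite !ltW.
have pE : cos r = p by rewrite acosK// in_itv/=.
have r0 : 0 < r by rewrite acos_gt0// p1 ltW.
have rpi : r < pi by rewrite acos_ltpi// p0 ltW.
have s0 : 0 < sin r by rewrite sin_gt0_pi// r0.
have sn0 := lt0r_neq0 s0; have rn0 := lt0r_neq0 r0.
have sq : Num.sqrt (1 - p ^+ 2) = sin r by rewrite sin_acos.
have hd xi : usphere xi -> dotp x xi = 0 -> \forall s \near (0 : R),
    is_derive (s : R) 1 (fun s => psi (circ x xi s) + gcost p (dotp xi y) s)
      (dotp (sgrad psi (circ x xi s)) (circ' x xi s) + gcost' p (dotp xi y) s).
  move=> xiS xxi; have := gcos_near (dotp xi y) p11; apply: filterS => s hs.
  exact: is_derive_addS (is_derive_circ xS xiS xxi psi_diff s) (is_derive_gcost hs).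
have hmin xi : usphere xi -> dotp x xi = 0 -> \forall s \near (0 : R),
    psi (circ x xi 0) + gcost p (dotp xi y) 0 <= psi (circ x xi s) + gcost p (dotp xi y) s.
  by move=> xiS xxi; near=> s; exact: contact_circ.
have vxi xi : usphere xi -> dotp x xi = 0 -> dotp v xi = r / sin r * dotp xi y.
  move=> xiS xxi.
  have := first_order_min (nbhs_singleton (hd xi xiS xxi)) _ (hmin xi xiS xxi).
  rewrite circ0 circ'0 /gcost' gcos0 gcos'0 sq -/v => h.
  have := h _; rewrite -/r => {}h.
  have : dotp v xi - r * (dotp xi y / sin r) = 0.
    by apply: h; apply: filterS (hd xi xiS xxi) => s [].
  by move/subr0_eq ->; rewrite mulrA mulrAC.
have xx := usphere_dotp xS; have yy := usphere_dotp yS.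
have vE : v = (r / sin r) *: (y - p *: x).
  apply/eqP; rewrite -subr_eq0; apply/eqP; apply: tangent_eq0.
    by rewrite !dotp_lin xx (sgrad_tangent psi_diff xS) -/p; ring.
  move=> xi xiS xxi; rewrite !dotp_lin xxi vxi// [dotp y xi]dotpC.
  by rewrite mulr0 subr0 subrr.
have vv : dotp v v = r ^+ 2.
  rewrite vE !dotp_lin xx yy [dotp y x]dotpC -/p -pE.
  have e := sin2cos2 r.
  transitivity (r ^+ 2 * ((1 - cos r ^+ 2) / sin r ^+ 2)); first by field.
  by rewrite -e divff ?mulr1// expf_neq0.
have nv : enorm v = r by rewrite /enorm vv sqrtr_sqr gtr0_norm.
split=> //; first by rewrite r0.
move=> xi dg xiS xxi hg.
have h' := is_derive_circ' xS xiS xxi psi_diff hg.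
have h2 := is_derive_addS h' (is_derive_gcost' (dotp xi y) p11).
have := second_order_min (hd xi xiS xxi) h2 (hmin xi xiS xxi).
congr (0 <= _ + _); rewrite /cost_hess /perp_form nv (usphere_dotp xiS) vv vxi// -/r.
have P0 : 0 < sin_defect r by apply: sin_defect_gt0; rewrite r0.
move: P0; rewrite /cost_ratio /sin_defect; move: (sin r) (cos r) sn0 => s c sn0 P0.
by field; rewrite sn0 rn0 gt_eqF.
Unshelve. all: by end_near. Qed.

End ContactConditions.

Lemma cost_hessZ (R : realType) m (v xi : 'rV[R]_m) (a : R) :
  cost_hess v (a *: xi) = a ^+ 2 * cost_hess v xi.
Proof. by rewrite /cost_hess /perp_form !dotp_lin; ring. Qed.

Lemma unit_tangent (R : realType) n (x : 'rV[R]_n.+2) : usphere x ->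
  exists2 xi, usphere xi & dotp x xi = 0.
Proof.
move=> xS; have [EE Ex _] := frame_oriented xS; exists (row 0 (frame x)).
  apply: dotp_usphere; have := congr1 (fun M : 'M[R]_n.+1 => M 0 0) EE.
  rewrite !mxE eqxx mulr1n => <-; rewrite dotpE; apply: eq_bigr => j _.
  by rewrite !mxE.
have := congr1 (fun M : 'M[R]_(n.+1, 1) => M 0 0) Ex.
rewrite !mxE => <-; rewrite dotpC dotpE; apply: eq_bigr => j _.
by rewrite !mxE.
Qed.

(** Assembles the cases <x, y> = 1 and -1 < <x, y> < 1, and extends the second
    order condition from unit vectors by homogeneity. *)
Lemma contact_conditions (R : realType) n (psi : 'rV[R]_n.+2 -> R) (x : 'rV[R]_n.+2) :
  c_convex psi ->
  (forall y, usphere y -> sdifferentiable (psi : _ -> R^o) y) -> usphere x ->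
  enorm (sgrad psi x) < pi /\
  forall xi, dotp x xi = 0 -> sdifferentiable (sgrad psi) x ->
    0 <= dotp ('d (sgrad psi \o @retr R n.+1) x xi) xi + cost_hess (sgrad psi x) xi.
Proof.
move=> cc psid xS; have [y yS contact] := c_convex_contact cc xS.
have [xi0 xi0S xxi0] := unit_tangent xS.
have pm := contact_not_antipodal psid xS yS contact xi0S xxi0.
have /andP[p0 p1] := dotp_usphere_itv xS yS.
have [vpi H] : enorm (sgrad psi x) < pi /\
    forall xi (dg : 'rV[R]_n.+2 -> 'rV[R]_n.+2), usphere xi -> dotp x xi = 0 ->
      is_diff x (sgrad psi \o @retr R n.+1) dg ->
      0 <= dotp (dg xi) xi + cost_hess (sgrad psi x) xi.
  have [p1E|pn1] := eqVneq (dotp x y) 1.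
    have [v0 H] := contact_coincide psid xS yS contact p1E.
    split; first by rewrite v0 enorm0 pi_gt0.
    move=> xi dg xiS xxi hg; have := H xi dg xiS xxi hg.
    by rewrite v0 /cost_hess /perp_form !dotp0l !mul0r subr0 mul0r subr0 usphere_dotp.
  have p11 : -1 < dotp x y < 1 by rewrite !lt_neqAle eq_sym pm p0 pn1.
  have [nv /andP[_ rpi] H] := contact_generic psid xS yS contact p11.
  by split => //; rewrite nv.
split=> // xi xxi gd.
have [->|xi0'] := eqVneq xi 0.
  by rewrite /cost_hess /perp_form !dotp0r !mulr0 subr0 mul0r subr0 addr0.
have e0 := enorm_gt0 xi0'.
have -> : xi = enorm xi *: retr xi by rewrite /retr scalerA divff ?scale1r// gt_eqF.
rewrite linearZ cost_hessZ dotpZl dotpZr mulrA -expr2 -mulrDr mulr_ge0 ?sqr_ge0//.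
apply: (H _ ('d (sgrad psi \o @retr R n.+1) x)) => //.
- exact: retr_usphere.
- by rewrite dotpZr xxi mulr0.
Qed.

(** * Log-concavity of the likelihood *)

Section HessianMatrix.
Variables (R : realType) (n : nat).
Local Notation V := ('rV[R]_n.+2).

Lemma possemidef_hess_mx (psi : V -> R) (x : V) :
  c_convex psi ->
  (forall y, usphere y -> sdifferentiable (psi : _ -> R^o) y) -> usphere x ->
  sdifferentiable (sgrad psi) x ->
  possemidef (hess_mx (frame x) (jacobian (sgrad psi \o @retr R n.+1) x) (sgrad psi x)).
Proof.
move=> cc psid xS gd.
have [vpi H] := contact_conditions cc psid xS.
have oE := frame_oriented xS; have [EE Ex _] := oE.
set E := frame x in oE EE Ex *; set D := jacobian _ x.
have hg : is_diff x (sgrad psi \o @retr R n.+1) ('d (sgrad psi \o @retr R n.+1) x).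
  exact: differentiableP.
have DE xi : xi *m D = 'd (sgrad psi \o @retr R n.+1) x xi.
  by rewrite /D /jacobian mul_rV_lin1.
have tang (u : 'rV_n.+1) : dotp x (u *m E) = 0.
  by rewrite dotpC /dotp -mulmxA Ex mulmx0 mxE.
split; last first.
  by move=> u; rewrite qform_hess_mx DE; apply: H.
rewrite /hess_mx mulmxDr mulmxDl linearD /=; congr (_ + _); last first.
  by rewrite !trmx_mul trmxK cost_hess_mx_sym mulmxA.
apply/matrixP => i j; rewrite mxE.
have entry k l : (E *m D *m E^T) k l = dotp (row k E *m D) (row l E).
  by rewrite /dotp -!row_mul tr_row !mxE; apply: eq_bigr => q _; rewrite !mxE.
rewrite !entry !DE; apply: (dgrad_sym psid xS hg).
  by rewrite rowE.
by rewrite rowE.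
Qed.

End HessianMatrix.

Section Potentials.
Variables (R : realType) (n p : nat).
Local Notation V := ('rV[R]_n.+1).
Variable phi : 'I_p -> V -> R.
Hypothesis phid : forall i y, usphere y -> sdifferentiable (phi i : _ -> R^o) y.

Lemma is_diff_potential theta y : usphere y ->
  is_diff y (potential phi theta \o @retr R n)
    (dotp (\sum_i theta 0 i *: sgrad (phi i) y)).
Proof.
move=> yS; apply: is_diff_ext
  (is_diff_lincomb (theta 0) (fun i => is_diff_sphere (@phid i) yS)) _ => h.
by rewrite dotp_suml; apply: eq_bigr => i _; rewrite dotpZl.
Qed.

Lemma potential_diff theta y : usphere y ->
  sdifferentiable (potential phi theta : _ -> R^o) y.
Proof. by move=> yS; case: (is_diff_potential theta yS). Qed.

Lemma sgrad_potential theta y : usphere y ->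
  sgrad (potential phi theta) y = \sum_i theta 0 i *: sgrad (phi i) y.
Proof.
move=> yS.
have := is_diff_unique (is_diff_sphere (potential_diff theta) yS)
  (is_diff_potential theta yS).
set a := sgrad _ y; set b := \sum_i _ => E.
apply/subr0_eq/dotp_eq0.
by rewrite dotpDl dotpNl E subrr.
Qed.

Lemma is_diff_sgrad_potential theta x : usphere x ->
  (forall i, sdifferentiable (sgrad (phi i)) x) ->
  is_diff x (sgrad (potential phi theta) \o @retr R n)
    (fun h => \sum_i theta 0 i *: 'd (sgrad (phi i) \o @retr R n) x h).
Proof.
move=> xS gd.
have h := is_diff_lincomb (theta 0) (fun i => differentiableP (gd i)).
apply: is_diff_near_eq h; near=> z.
rewrite /= sgrad_potential//; apply: retr_usphere.
by near: z; exact: near_neq0.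
Unshelve. all: by end_near. Qed.

End Potentials.

Lemma affine_comb_le (R : realType) (t q0 q1 qt a0 a1 at_ b0 b1 bt : R) :
  q0 = a0 + b0 -> q1 = a1 + b1 -> qt = at_ + bt ->
  at_ = (1 - t) * a0 + t * a1 -> (1 - t) * b0 + t * b1 <= bt ->
  (1 - t) * q0 + t * q1 <= qt.
Proof. by move=> -> -> -> ->; lra. Qed.

Lemma powR_mul_le (R : realType) (n : nat) (t q0 q1 qt a0 a1 at_ b0 b1 bt : R) :
  q0 = a0 * b0 ^+ n -> q1 = a1 * b1 ^+ n -> qt = at_ * bt ^+ n ->
  0 <= a0 -> 0 <= a1 -> 0 < b0 -> 0 < b1 ->
  a0 `^ (1 - t) * a1 `^ t <= at_ -> b0 `^ (1 - t) * b1 `^ t <= bt ->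
  q0 `^ (1 - t) * q1 `^ t <= qt.
Proof.
move=> -> -> -> a00 a10 b00 b10 ale ble.
have powX (a b : R) : 0 < a -> (a ^+ n) `^ b = (a `^ b) ^+ n.
  move=> /ltW a_ge0; rewrite -(powR_mulrn _ a_ge0) -(powR_mulrn _ (powR_ge0 _ _)).
  by rewrite -!powRrM mulrC.
rewrite !powRM ?exprn_ge0 ?(ltW b00) ?(ltW b10)//.
rewrite mulrACA; apply: ler_pM => //.
- by rewrite mulr_ge0 ?powR_ge0.
- by rewrite mulr_ge0 ?powR_ge0.
rewrite !powX// -exprMn.
by apply: lerXn2r => //; rewrite nnegrE ?mulr_ge0 ?powR_ge0// (le_trans _ ble)// mulr_ge0 ?powR_ge0.
Qed.

Lemma prod_powR_le (R : realType) (m : nat) (f g h : 'I_m -> R) (a b : R) :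
  (forall k, 0 <= f k) -> (forall k, 0 <= g k) ->
  (forall k, f k `^ a * g k `^ b <= h k) ->
  (\prod_k f k) `^ a * (\prod_k g k) `^ b <= \prod_k h k.
Proof.
have powR_prod (F : 'I_m -> R) c : (forall k, 0 <= F k) ->
    (\prod_k F k) `^ c = \prod_k F k `^ c.
  move=> F0; have [] : 0 <= \prod_k F k /\ (\prod_k F k) `^ c = \prod_k F k `^ c.
    elim/big_rec2: _ => [|k q q' _ [q0 E]]; first by rewrite powR1.
    by rewrite mulr_ge0 ?F0// powRM ?F0// E.
  by [].
move=> f0 g0 fgh; rewrite !powR_prod// -big_split /=.
by apply: ler_prod => k _; rewrite fgh mulr_ge0 ?powR_ge0.
Qed.

Section Density.
Variables (R : realType) (n p : nat).
Local Notation V := ('rV[R]_n.+2).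
Variables (phi : 'I_p -> V -> R) (Theta : set 'rV[R]_p) (x : V).
Hypothesis phid : forall i y, usphere y -> sdifferentiable (phi i : _ -> R^o) y.
Hypothesis ThetaC : forall theta, Theta theta -> c_convex (potential phi theta).
Hypothesis xS : usphere x.
Hypothesis gd : forall i, sdifferentiable (sgrad (phi i)) x.

Let v theta := sgrad (potential phi theta) x.
Let H theta := hess_mx (frame x)
  (jacobian (sgrad (potential phi theta) \o @retr R n.+1) x) (v theta).

Lemma sgrad_conv (theta theta' : 'rV[R]_p) (t : R) :
  v ((1 - t) *: theta + t *: theta') = (1 - t) *: v theta + t *: v theta'.
Proof.
rewrite /v !sgrad_potential// !scaler_sumr -big_split; apply: eq_bigr => i _.
by rewrite !mxE [LHS]scalerDl -!scalerA.
Qed.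

Let gd' theta : sdifferentiable (sgrad (potential phi theta)) x.
Proof. by case: (is_diff_sgrad_potential phid theta xS gd). Qed.

Lemma sgrad_lt_pi theta : Theta theta -> enorm (v theta) < pi.
Proof.
move=> th.
by have [] := contact_conditions (ThetaC th) (potential_diff phid theta) xS.
Qed.

Lemma possemidef_hess theta : Theta theta -> possemidef (H theta).
Proof.
by move=> th; apply: possemidef_hess_mx => //; [exact: ThetaC|exact: potential_diff].
Qed.

(** The Hessian of the potential is linear in theta, so the gap is that of
    [cost_hess_concave]. *)
Lemma qform_hess_concave theta theta' (t : R) u : Theta theta -> Theta theta' ->
  0 <= t <= 1 ->
  (1 - t) * qform (H theta) u + t * qform (H theta') u <=
  qform (H ((1 - t) *: theta + t *: theta')) u.
Proof.
move=> th th' t01; set xi := u *m frame x.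
pose w (b : 'rV[R]_p) := \sum_i b 0 i *: 'd (sgrad (phi i) \o @retr R n.+1) x xi.
have qH b : qform (H b) u = dotp (w b) xi + cost_hess (v b) xi.
  rewrite /H qform_hess_mx /jacobian mul_rV_lin1.
  by have [_ ->] := is_diff_sgrad_potential phid b xS gd.
have wE : w ((1 - t) *: theta + t *: theta') = (1 - t) *: w theta + t *: w theta'.
  rewrite /w !scaler_sumr -big_split; apply: eq_bigr => i _.
  by rewrite !mxE [LHS]scalerDl -!scalerA.
have dE : dotp (w ((1 - t) *: theta + t *: theta')) xi =
    (1 - t) * dotp (w theta) xi + t * dotp (w theta') xi.
  by rewrite wE dotpDl !dotpZl.
have cE := cost_hess_concave xi t01 (sgrad_lt_pi th) (sgrad_lt_pi th').
rewrite -sgrad_conv in cE.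
exact: affine_comb_le (qH _) (qH _) (qH _) dE cE.
Qed.

Lemma density_factor theta : Theta theta ->
  density phi x theta = \det (H theta) * sinc (enorm (v theta)) ^+ n.
Proof.
move=> th; apply: Jac_gradient_map => //; first exact: potential_diff.
exact: sgrad_lt_pi.
Qed.

Lemma density_ge0 theta : Theta theta -> 0 <= density phi x theta.
Proof.
move=> th; rewrite density_factor//; apply: mulr_ge0.
  exact/possemidef_det_ge0/possemidef_hess.
by apply/exprn_ge0/ltW; rewrite sinc_gt0// enorm_ge0 sgrad_lt_pi.
Qed.

Lemma density_log_concave theta theta' (t : R) : 0 < t < 1 ->
  Theta theta -> Theta theta' -> Theta ((1 - t) *: theta + t *: theta') ->
  density phi x theta `^ (1 - t) * density phi x theta' `^ t <=
  density phi x ((1 - t) *: theta + t *: theta').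
Proof.
move=> t01 th th' tht; have /andP[t0 t1] := t01.
have t01' : 0 <= t <= 1 by rewrite !ltW.
have s_gt0 b : Theta b -> 0 < sinc (enorm (v b)).
  by move=> tb; rewrite sinc_gt0// enorm_ge0 sgrad_lt_pi.
have d_ge0 b : Theta b -> 0 <= \det (H b).
  by move=> tb; rewrite possemidef_det_ge0//; exact: possemidef_hess.
apply: (powR_mul_le (density_factor th) (density_factor th') (density_factor tht)
  (d_ge0 _ th) (d_ge0 _ th') (s_gt0 _ th) (s_gt0 _ th')).
  exact: (det_log_concave t01 (possemidef_hess th) (possemidef_hess th') (possemidef_hess tht)
    (fun u => qform_hess_concave u th th' t01')).
have nv b : Theta b -> 0 <= enorm (v b) < pi.
  by move=> tb; rewrite enorm_ge0 sgrad_lt_pi.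
apply: (sinc_log_concave (nv _ th) (nv _ th') t01' (enorm_ge0 _)).
rewrite sgrad_conv; apply: (le_trans (ler_enormD _ _)).
by rewrite !enormZ !ger0_norm ?subr_ge0 ?(ltW t0) ?(ltW t1).
Qed.

End Density.

Lemma convex_set_comb (R : realType) (p : nat) (Theta : set 'rV[R]_p)
    (theta theta' : 'rV[R]_p) (t : R) : convex_set Theta ->
  0 < t < 1 -> Theta theta -> Theta theta' ->
  Theta ((1 - t) *: theta + t *: theta').
Proof.
move=> cv /andP[t0 t1] th th'.
pose l : {i01 R} := Itv01 (ltW t0) (ltW t1).
have := cv theta' theta l.
rewrite !inE => /(_ th' th).
by rewrite addrC.
Qed.

Lemma Jac_dim0 (R : realType) (G : 'rV[R]_1 -> 'rV[R]_1) x : Jac G x = 1.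
Proof. by rewrite /Jac det_mx00. Qed.

Theorem corollary1 (R : realType) (n p N : nat)
    (phi : 'I_p -> 'rV[R]_n.+1 -> R)
    (phiW : forall i : 'I_p, wrapping (phi i))
    (Theta : set 'rV[R]_p)
    (convexTheta : convex_set Theta)
    (ThetaW : forall theta : 'rV[R]_p,
       Theta theta -> wrapping (potential phi theta))
    (x : 'I_N -> 'rV[R]_n.+1)
    (xS : forall k : 'I_N, usphere (x k))
    (xH : forall (k : 'I_N) (i : 'I_p), hessian_defined (phi i) (x k)) :
  log_concave Theta
    (fun theta : 'rV[R]_p => \prod_(k < N) density phi (x k) theta).
Proof.
have [ge0 lc] : (forall k theta, Theta theta -> 0 <= density phi (x k) theta) /\
  (forall k (theta theta' : 'rV[R]_p) (t : R), 0 < t < 1 ->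
     Theta theta -> Theta theta' ->
     density phi (x k) theta `^ (1 - t) * density phi (x k) theta' `^ t <=
     density phi (x k) ((1 - t) *: theta + t *: theta')).
  case: n phi phiW ThetaW x xS xH => [|n] phi phiW ThetaW x xS xH.
    split=> [k theta _|k theta theta' t _ _ _]; rewrite /density !Jac_dim0//.
    by rewrite !powR1 mulr1.
  have phid i y : usphere y -> sdifferentiable (phi i : _ -> R^o) y.
    by have [_ _ h _] := phiW i; exact: h.
  have cc theta : Theta theta -> c_convex (potential phi theta).
    by move=> /ThetaW[].
  have gd k i : sdifferentiable (sgrad (phi i)) (x k) by have [_ h] := xH k i.
  split=> [k theta|k theta theta' t t01 th th'].
    exact: (density_ge0 phid cc (xS k) (gd k)).
  apply: (density_log_concave phid cc (xS k) (gd k)) => //.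
  exact: convex_set_comb.
split=> [theta th|theta theta' t th th' t01].
  by apply: prodr_ge0 => k _; exact: ge0.
exact: (prod_powR_le (fun k => ge0 k _ th) (fun k => ge0 k _ th')
  (fun k => lc k theta theta' t t01 th th')).
Qed.
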